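(* Let $\pi:R\to S$ be an epimorphism between unital rings. For any extended Sylvester map rank function $\mathrm{rk}_R$ for $R$, the following are equivalent (where $S$-modules are regarded as $R$-modules via $\pi$, and $\pi:R\to S$ is regarded as a map of left $R$-modules): (1) $\mathrm{rk}_R\in\pi^*(\mathbb{P}(S))$. (2) $\mathrm{rk}_R(\mathrm{id}_S\otimes_R\alpha)=\mathrm{rk}_R(\alpha)$ for any map $\alpha:\mathcal{M}_1\to\mathcal{M}_2$ between $R$-modules. (3) $\mathrm{rk}_R(\mathrm{id}_S\otimes_R\mathrm{id}_{\mathcal{M}})=\mathrm{rk}_R(\mathrm{id}_{\mathcal{M}})$ for any finitely presented $R$-module $\mathcal{M}$. (4) $\mathrm{rk}_R(\pi)=\mathrm{rk}_R(\mathrm{id}_S)=1$.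
   Context: All modules are left modules; maps between modules are module homomorphisms, written on the right of their arguments, so $\alpha\beta$ means first $\alpha$, then $\beta$. A unital ring homomorphism $\pi:R\to S$ is an epimorphism if any two unital ring homomorphisms from $S$ to a unital ring $Q$ that agree after precomposing with $\pi$ are equal. An extended Sylvester map rank function for a unital ring $R$ is an $\mathbb{R}_{\ge 0}\cup\{+\infty\}$-valued function $\mathrm{rk}$ on the class of all maps between $R$-modules such that: (1) $\mathrm{rk}(0)=0$, $\mathrm{rk}(\mathrm{id}_R)=1$; (2) $\mathrm{rk}(\alpha\beta)\le\min(\mathrm{rk}(\alpha),\mathrm{rk}(\beta))$ for composable maps; (3) $\mathrm{rk}(\alpha\oplus\beta)=\mathrm{rk}(\alpha)+\mathrm{rk}(\beta)$; (4) if $(\mathcal{M}_j,\beta_{jk})$ is a direct system of $R$-modules over a directed set $J$ with direct limit $\mathcal{M}_\infty$ and canonical maps $\beta_j:\mathcal{M}_j\to\mathcal{M}_\infty$, and $\alpha_j:\mathcal{M}_j\to\mathcal{M}$, $\alpha_\infty:\mathcal{M}_\infty\to\mathcal{M}$ are maps to an $R$-module $\mathcal{M}$ with $\beta_{jk}\alpha_k=\alpha_j$ for $j\le k$ and $\beta_j\alpha_\infty=\alpha_j$ for all $j$, then $\mathrm{rk}(\alpha_\infty)=\lim_{j\to\infty}\mathrm{rk}(\alpha_j)$; (5) if $(\mathcal{M}_j,\beta_{jk})$, $\mathcal{M}_\infty$, $\beta_j$ are as in (4), and $\alpha_j:\mathcal{M}\to\mathcal{M}_j$, $\alpha_\infty:\mathcal{M}\to\mathcal{M}_\infty$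 are maps from a finitely generated $R$-module $\mathcal{M}$ with $\alpha_j\beta_{jk}=\alpha_k$ for $j\le k$ and $\alpha_j\beta_j=\alpha_\infty$ for all $j$, then $\mathrm{rk}(\alpha_\infty)=\lim_{j\to\infty}\mathrm{rk}(\alpha_j)$; (6) for any map $\alpha:\mathcal{M}_1\to\mathcal{M}_2$, $\mathrm{rk}(\mathrm{id}_{\mathcal{M}_2})=\mathrm{rk}(\alpha)+\mathrm{rk}(\mathrm{id}_{\mathrm{coker}(\alpha)})$. $\mathbb{P}(S)$ denotes the set of all Sylvester rank functions for $S$, here taken to be the extended Sylvester map rank functions for $S$. The map $\pi^*:\mathbb{P}(S)\to\mathbb{P}(R)$ is given by $\pi^*(\mathrm{rk}_S)(\alpha):=\mathrm{rk}_S(\mathrm{id}_S\otimes_R\alpha)$ for all maps $\alpha$ between $R$-modules. *)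

(* Defs.v *)
From HB Require Import structures.
From mathcomp Require Import all_boot all_order all_algebra.
From mathcomp Require Import all_classical all_reals all_analysis.
From mathcomp Require Import freeg.

Set Implicit Arguments.
Unset Strict Implicit.
Unset Printing Implicit Defensive.

Import Order.TTheory GRing.Theory Num.Theory.

Local Open Scope quotient_scope.
Local Open Scope ring_scope.

(* Unital rings are [pzRingType], so that the zero ring is included; left
   R-modules are [lmodType R].  All composites are written in Rocq's order:
   [g \o f] is first [f], then [g]. *)

Section QuotLift.
Variables (V : zmodType) (I : zmodClosed V).

Lemma quot_eqP (x y : V) :
  \pi_({ideal_quot I}) x = \pi y <-> x - y \in I.
Proof.
rewrite Quotient.idealrBE; split; first by move=> h; apply/eqP.
by move=> /eqP.
Qed.

Definition quot_lift (W : Type) (f : V -> W) (x : {ideal_quot I}) : W :=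
  f (repr x).

Lemma quot_liftE (W : zmodType) (f : {additive V -> W}) :
  (forall x, x \in I -> f x = 0) ->
  forall x : V, quot_lift f (\pi_({ideal_quot I}) x) = f x.
Proof.
move=> fI x; rewrite /quot_lift; apply/eqP; rewrite -subr_eq0 -raddfB.
by apply/eqP/fI/quot_eqP; rewrite reprK.
Qed.

End QuotLift.

Section Cokernel.
Variables (R : pzRingType) (M N : lmodType R) (f : {linear M -> N}).

Definition lin_im : {pred N} := [pred y | `[< exists x, f x = y >]].

Fact lin_im_submod : submod_closed lin_im.
Proof.
split=> [|a _ _ /asboolP[x <-] /asboolP[y <-]]; apply/asboolP.
  by exists 0; rewrite linear0.
by exists (a *: x + y); rewrite linearP.
Qed.

HB.instance Definition _ := GRing.isSubmodClosed.Build R N lin_im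
  (GRing.submod_closed_semi lin_im_submod).

(* The abelian group N / lin_im, made a left R-module below. *)
Definition coker : Type := {ideal_quot lin_im}.
HB.instance Definition _ := GRing.Zmodule.on coker.

Definition coker_pi (y : N) : coker := \pi_({ideal_quot lin_im}) y.

Fact coker_pi_is_zmod : zmod_morphism coker_pi.
Proof. exact: raddfB. Qed.
HB.instance Definition _ :=
  GRing.isZmodMorphism.Build N coker coker_pi coker_pi_is_zmod.

Lemma coker_piP (P : coker -> Prop) :
  (forall y, P (coker_pi y)) -> forall c, P c.
Proof. by move=> h; elim/quotW. Qed.

Lemma coker_pi_eq0 y : coker_pi y = 0 <-> exists x, f x = y.
Proof.
rewrite -(raddf0 coker_pi); split=> [/quot_eqP|h].
  by rewrite subr0 => /asboolP.
by apply/quot_eqP; rewrite subr0; apply/asboolP.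
Qed.

Definition coker_scale (a : R) : coker -> coker :=
  quot_lift (fun y : N => coker_pi (a *: y)).

Lemma coker_scaleE a y : coker_scale a (coker_pi y) = coker_pi (a *: y).
Proof.
apply/quot_eqP; rewrite -scalerBr rpredZ //.
by apply/quot_eqP; rewrite reprK.
Qed.

Fact coker_scaleA a b x :
  coker_scale a (coker_scale b x) = coker_scale (a * b) x.
Proof. by elim/coker_piP: x => x; rewrite !coker_scaleE scalerA. Qed.

Fact coker_scale1 : left_id 1 coker_scale.
Proof. by elim/coker_piP => x; rewrite coker_scaleE scale1r. Qed.

Fact coker_scaleDr : right_distributive coker_scale +%R.
Proof.
move=> a; elim/coker_piP => x; elim/coker_piP => y.
by rewrite -raddfD !coker_scaleE scalerDr raddfD.
Qed.

Fact coker_scaleDl x : {morph coker_scale^~ x : a b / a + b}.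
Proof. by elim/coker_piP: x => x a b; rewrite !coker_scaleE scalerDl raddfD. Qed.

HB.instance Definition _ := GRing.Zmodule_isLmodule.Build R coker
  coker_scaleA coker_scale1 coker_scaleDr coker_scaleDl.

Fact coker_pi_is_scalable : scalable coker_pi.
Proof. by move=> a x; rewrite -coker_scaleE. Qed.
HB.instance Definition _ :=
  GRing.isScalable.Build R N coker *:%R coker_pi coker_pi_is_scalable.

End Cokernel.

(* [pi] is a phantom argument: the R-module instance below is keyed on the
   alias [restr pi N] and acts by r *: x := pi r *: x. *)
Definition restr (R S : pzRingType) (pi : {rmorphism R -> S}) (N : lmodType S) :
  Type := N.

Section Restriction.
Variables (R S : pzRingType) (pi : {rmorphism R -> S}).
Local Notation restr := (restr pi).

Section Module.
Variable N : lmodType S.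

HB.instance Definition _ := GRing.Zmodule.on (restr N).

Definition restr_scale (r : R) (x : restr N) : restr N := pi r *: (x : N).

Fact restr_scaleA a b x : restr_scale a (restr_scale b x) = restr_scale (a * b) x.
Proof. by rewrite /restr_scale scalerA rmorphM. Qed.

Fact restr_scale1 : left_id 1 restr_scale.
Proof. by move=> x; rewrite /restr_scale rmorph1 scale1r. Qed.

Fact restr_scaleDr : right_distributive restr_scale +%R.
Proof. by move=> a x y; apply: scalerDr. Qed.

Fact restr_scaleDl x : {morph restr_scale^~ x : a b / a + b}.
Proof. by move=> a b; rewrite /restr_scale rmorphD scalerDl. Qed.

HB.instance Definition _ := GRing.Zmodule_isLmodule.Build R (restr N)
  restr_scaleA restr_scale1 restr_scaleDr restr_scaleDl.

End Module.

Definition restr_map (N1 N2 : lmodType S) (f : {linear N1 -> N2}) :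
  restr N1 -> restr N2 := f.

Fact restr_map_is_linear (N1 N2 : lmodType S) (f : {linear N1 -> N2}) :
  linear (restr_map f).
Proof. by move=> a x y; apply: linearP. Qed.

HB.instance Definition _ (N1 N2 : lmodType S) (f : {linear N1 -> N2}) :=
  GRing.isLinear.Build R (restr N1) (restr N2) *:%R (restr_map f)
    (restr_map_is_linear f).

(* [pi] as a map of left R-modules. *)
Definition pi_map : R^o -> restr S^o := pi.

Fact pi_map_is_linear : linear pi_map.
Proof. by move=> a x y; rewrite /pi_map rmorphD rmorphM. Qed.

HB.instance Definition _ :=
  GRing.isLinear.Build R R^o (restr S^o) *:%R pi_map pi_map_is_linear.

End Restriction.

Arguments restr_map {R S} pi {N1 N2} f x.
Arguments pi_map {R S} pi x.

Section Tensor.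
Variables (R S : pzRingType) (pi : {rmorphism R -> S}) (M : lmodType R).

Local Notation F := {freeg (S * M) / int}.
Local Notation gen s m := (<< (s, m) >> : F).

(* The subgroup of the free abelian group on S * M generated by the relations
   of balanced biadditivity, S being a right R-module through [pi]. *)
Inductive tens_rel : F -> Prop :=
| TensRel0 : tens_rel 0
| TensRelB x y : tens_rel x -> tens_rel y -> tens_rel (x - y)
| TensRelDl s s' m : tens_rel (gen (s + s') m - gen s m - gen s' m)
| TensRelDr s m m' : tens_rel (gen s (m + m') - gen s m - gen s m')
| TensRelZ s r m : tens_rel (gen (s * pi r) m - gen s (r *: m)).

Definition tens_relb : {pred F} := [pred x | `[< tens_rel x >]].

Fact tens_relb_closed : zmod_closed tens_relb.
Proof.
split=> [|x y /asboolP hx /asboolP hy]; apply/asboolP; first exact: TensRel0.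
exact: TensRelB.
Qed.

HB.instance Definition _ :=
  GRing.isZmodClosed.Build F tens_relb tens_relb_closed.

(* S (x)_R M, made a left S-module below by a *: (s (x) m) = (a * s) (x) m;
   [pure s m] is s (x) m, and [tens_lift] the universal property. *)
Definition tens : Type := {ideal_quot tens_relb}.
HB.instance Definition _ := GRing.Zmodule.on tens.

Definition tens_pi (x : F) : tens := \pi_({ideal_quot tens_relb}) x.

Fact tens_pi_is_zmod : zmod_morphism tens_pi.
Proof. exact: raddfB. Qed.
HB.instance Definition _ :=
  GRing.isZmodMorphism.Build F tens tens_pi tens_pi_is_zmod.

Lemma tens_piP (P : tens -> Prop) :
  (forall x, P (tens_pi x)) -> forall t, P t.
Proof. by move=> h; elim/quotW. Qed.

Lemma tens_pi_eq x y : tens_rel (x - y) -> tens_pi x = tens_pi y.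
Proof. by move=> h; apply/quot_eqP/asboolP. Qed.

Definition pure (s : S) (m : M) : tens := tens_pi (gen s m).

Lemma pureDl s s' m : pure (s + s') m = pure s m + pure s' m.
Proof.
by rewrite -raddfD; apply: tens_pi_eq; rewrite opprD addrA; apply: TensRelDl.
Qed.

Lemma pureDr s m m' : pure s (m + m') = pure s m + pure s m'.
Proof.
by rewrite -raddfD; apply: tens_pi_eq; rewrite opprD addrA; apply: TensRelDr.
Qed.

Lemma pureZ s r m : pure (s * pi r) m = pure s (r *: m).
Proof. exact/tens_pi_eq/TensRelZ. Qed.

Section Lift.
Variables (V : zmodType) (b : S -> M -> V).

Definition balanced : Prop :=
  [/\ forall s s' m, b (s + s') m = b s m + b s' m,
      forall s m m', b s (m + m') = b s m + b s m'
    & forall s r m, b (s * pi r) m = b s (r *: m)].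

Definition tens_lift0 (x : F) : V :=
  fglift (fun sm : S * M => b sm.1 sm.2 : zmodule V) x.

Fact tens_lift0_is_zmod : zmod_morphism tens_lift0.
Proof.
exact: (@lift_is_additive int (S * M)%type (zmodule V)
  (fun sm => b sm.1 sm.2)).
Qed.
HB.instance Definition _ :=
  GRing.isZmodMorphism.Build F V tens_lift0 tens_lift0_is_zmod.

Lemma tens_lift0_gen s m : tens_lift0 (gen s m) = b s m.
Proof. by rewrite /tens_lift0 liftU. Qed.

Definition tens_lift : tens -> V := quot_lift tens_lift0.

Lemma tens_lift0_rel : balanced -> forall x, tens_rel x -> tens_lift0 x = 0.
Proof.
case=> bDl bDr bZ x; elim=> [|{}x y _ hx _ hy|s s' m|s m m'|s r m].
- exact: raddf0.
- by rewrite raddfB /= hx hy subr0.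
- by rewrite !raddfB /= !tens_lift0_gen bDl -addrA -opprD addrN.
- by rewrite !raddfB /= !tens_lift0_gen bDr -addrA -opprD addrN.
- by rewrite raddfB /= !tens_lift0_gen bZ addrN.
Qed.

Lemma tens_lift_pi x : balanced ->
  tens_lift (tens_pi x) = tens_lift0 x.
Proof.
move=> bb; apply: (quot_liftE (f := tens_lift0)) => y /asboolP.
exact: tens_lift0_rel.
Qed.

Lemma tens_liftE s m : balanced -> tens_lift (pure s m) = b s m.
Proof. by move=> bb; rewrite tens_lift_pi // tens_lift0_gen. Qed.

Lemma tens_liftB : balanced -> zmod_morphism tens_lift.
Proof.
move=> bb; elim/tens_piP => x; elim/tens_piP => y.
by rewrite -raddfB !tens_lift_pi // raddfB.
Qed.

End Lift.

Lemma tens_ind (P : tens -> Prop) :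
  P 0 -> (forall x y, P x -> P y -> P (x - y)) -> (forall s m, P (pure s m)) ->
  forall x, P x.
Proof.
move=> P0 PB Ppure; elim/tens_piP.
have PN x : P x -> P (- x) by rewrite -sub0r; apply: PB.
have PD x y : P x -> P y -> P (x + y).
  by move=> hx hy; rewrite -[y]opprK; apply: PB => //; apply: PN.
have Pn x n : P x -> P (x *+ n).
  by move=> hx; elim: n => // n IHn; rewrite mulrS; apply: PD.
elim/freeg_ind_dom0 => [|k [s m] x _ _ hx]; first by rewrite raddf0.
rewrite raddfD; apply: PD => //.
have -> : << k *g (s, m) >> = gen s m *~ k by rewrite freegU_mulz intz.
rewrite raddfMz; case: k => n; first exact: (Pn _ _ (Ppure s m)).
exact: (PN _ (Pn _ n.+1 (Ppure s m))).
Qed.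

End Tensor.

Section TensorModule.
Variables (R S : pzRingType) (pi : {rmorphism R -> S}) (M : lmodType R).
Local Notation T := (tens pi M).

Definition tens_scale (a : S) : T -> T :=
  tens_lift (fun s m => pure pi (a * s) m).

Fact tens_scale_balanced a :
  balanced pi (fun (s : S) (m : M) => pure pi (a * s) m).
Proof.
by split=> *; rewrite ?mulrDr ?mulrA ?pureDl ?pureDr ?pureZ.
Qed.

Lemma tens_scaleE a s m : tens_scale a (pure pi s m) = pure pi (a * s) m.
Proof. exact/tens_liftE/tens_scale_balanced. Qed.

Fact tens_scale_is_zmod a : zmod_morphism (tens_scale a).
Proof. exact/tens_liftB/tens_scale_balanced. Qed.

HB.instance Definition _ a :=
  GRing.isZmodMorphism.Build T T (tens_scale a) (tens_scale_is_zmod a).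

Fact tens_scaleA a b x : tens_scale a (tens_scale b x) = tens_scale (a * b) x.
Proof.
elim/tens_ind: x => [|x y hx hy|s m]; first by rewrite !raddf0.
  by rewrite !raddfB /= hx hy.
by rewrite !tens_scaleE mulrA.
Qed.

Fact tens_scale1 : left_id 1 tens_scale.
Proof.
elim/tens_ind=> [|x y hx hy|s m]; first by rewrite raddf0.
  by rewrite raddfB /= hx hy.
by rewrite tens_scaleE mul1r.
Qed.

Fact tens_scaleDr : right_distributive tens_scale +%R.
Proof. by move=> a x y; rewrite raddfD. Qed.

Fact tens_scaleDl x : {morph tens_scale^~ x : a b / a + b}.
Proof.
move=> a b; elim/tens_ind: x => [|x y hx hy|s m].
- by rewrite !raddf0 addr0.
- by rewrite !raddfB /= hx hy opprD addrACA.
- by rewrite !tens_scaleE mulrDl pureDl.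
Qed.

HB.instance Definition _ := GRing.Zmodule_isLmodule.Build S T
  tens_scaleA tens_scale1 tens_scaleDr tens_scaleDl.

Lemma pure_scale a s m : a *: pure pi s m = pure pi (a * s) m.
Proof. exact: tens_scaleE. Qed.

End TensorModule.

(* The map id_S (x)_R f of left S-modules. *)
Section TensorMap.
Variables (R S : pzRingType) (pi : {rmorphism R -> S}).
Variables (M N : lmodType R) (f : {linear M -> N}).

Definition tens_map : tens pi M -> tens pi N :=
  tens_lift (fun s m => pure pi s (f m)).

Fact tens_map_balanced : balanced pi (fun (s : S) (m : M) => pure pi s (f m)).
Proof. by split=> *; rewrite ?linearD ?linearZ ?pureDl ?pureDr ?pureZ. Qed.

Lemma tens_mapE s m : tens_map (pure pi s m) = pure pi s (f m).
Proof. exact/tens_liftE/tens_map_balanced. Qed.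

Fact tens_map_is_zmod : zmod_morphism tens_map.
Proof. exact/tens_liftB/tens_map_balanced. Qed.

HB.instance Definition _ :=
  GRing.isZmodMorphism.Build (tens pi M) (tens pi N) tens_map tens_map_is_zmod.

Fact tens_map_is_scalable : scalable tens_map.
Proof.
move=> a; elim/tens_ind=> [|x y hx hy|s m]; first by rewrite !(raddf0, scaler0).
  by rewrite !(raddfB, scalerBr) /= hx hy.
by rewrite pure_scale !tens_mapE pure_scale.
Qed.

HB.instance Definition _ :=
  GRing.isScalable.Build S (tens pi M) (tens pi N) *:%R tens_map
    tens_map_is_scalable.

End TensorMap.

Arguments tens_map {R S} pi {M N} f x.

Definition ring_epi (R S : pzRingType) (pi : {rmorphism R -> S}) : Prop :=
  forall (Q : pzRingType) (f g : {rmorphism S -> Q}),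
    f \o pi =1 g \o pi -> f =1 g.

Definition in_span (R : pzRingType) (M : lmodType R) (n : nat) (g : 'I_n -> M)
    (x : M) : Prop :=
  exists c : 'I_n -> R, x = \sum_(i < n) c i *: g i.

Definition fin_gen (R : pzRingType) (M : lmodType R) : Prop :=
  exists (n : nat) (g : 'I_n -> M), forall x, in_span g x.

Definition fin_pres (R : pzRingType) (M : lmodType R) : Prop :=
  exists (n : nat) (p : {linear 'rV[R]_n -> M}),
    (forall x, exists v, p v = x) /\
    exists (m : nat) (k : 'I_m -> 'rV[R]_n), forall v, p v = 0 <-> in_span k v.

Section DirectSum.
Variables (R : pzRingType) (M1 N1 M2 N2 : lmodType R).
Variables (f : {linear M1 -> N1}) (g : {linear M2 -> N2}).

Definition dsum_map (x : M1 * M2) : N1 * N2 := (f x.1, g x.2).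

Fact dsum_map_is_linear : linear dsum_map.
Proof. by move=> a x y; rewrite /dsum_map !linearP. Qed.

HB.instance Definition _ :=
  GRing.isLinear.Build R (M1 * M2)%type (N1 * N2)%type *:%R dsum_map
    dsum_map_is_linear.

End DirectSum.

Record directed_set := DirectedSet {
  ds_car :> Type;
  ds_le : ds_car -> ds_car -> Prop;
  ds_refl : forall i, ds_le i i;
  ds_trans : forall i j k, ds_le i j -> ds_le j k -> ds_le i k;
  ds_inh : inhabited ds_car;
  ds_ub : forall i j, exists k, ds_le i k /\ ds_le j k }.

(* Convergence of nets indexed by J is convergence along this filter. *)
Definition tail_filter (J : directed_set) : set_system J :=
  filter_from setT (fun j : J => [set k | ds_le j k]%classic).

Arguments tail_filter : clear implicits.

Record direct_system (R : pzRingType) (J : directed_set) := DirectSystem {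
  dsys_obj :> J -> lmodType R;
  dsys_map : forall j k, ds_le j k -> {linear dsys_obj j -> dsys_obj k};
  dsys_id : forall j (h : ds_le j j), dsys_map h =1 id;
  dsys_comp : forall i j k (hij : ds_le i j) (hjk : ds_le j k) (hik : ds_le i k),
    dsys_map hjk \o dsys_map hij =1 dsys_map hik }.

Section DirectLimit.
Variables (R : pzRingType) (J : directed_set) (D : direct_system R J).

Definition is_cocone (T : lmodType R) (t : forall j, {linear D j -> T}) : Prop :=
  forall j k (h : ds_le j k), t k \o dsys_map D h =1 t j.

Definition is_direct_limit (L : lmodType R) (b : forall j, {linear D j -> L}) :
    Prop :=
  is_cocone b /\
  forall (T : lmodType R) (t : forall j, {linear D j -> T}), is_cocone t ->
    exists h : {linear L -> T}, (forall j, h \o b j =1 t j) /\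
      forall h' : {linear L -> T}, (forall j, h' \o b j =1 t j) -> h' =1 h.

End DirectLimit.

Definition map_rank (K : realType) (R : pzRingType) : Type :=
  forall M N : lmodType R, {linear M -> N} -> \bar K.

Section Sylvester.
Variables (K : realType) (R : pzRingType).

Definition idl (M : lmodType R) : {linear M -> M} := idfun.

Local Open Scope classical_set_scope.
Local Open Scope ereal_scope.

Record sylvester (rk : map_rank K R) : Prop := Sylvester {
  syl_ge0 : forall (M N : lmodType R) (f : {linear M -> N}), 0 <= rk M N f;
  syl_0 : forall M N : lmodType R, rk M N \0%R = 0;
  syl_1 : rk _ _ (idl R^o) = 1;
  syl_comp : forall (M N P : lmodType R) (f : {linear M -> N})
      (g : {linear N -> P}),
    rk M P (g \o f) <= Order.min (rk M N f) (rk N P g);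
  syl_sum : forall (M1 N1 M2 N2 : lmodType R) (f : {linear M1 -> N1})
      (g : {linear M2 -> N2}),
    rk _ _ (dsum_map f g) = rk _ _ f + rk _ _ g;
  syl_lim_dom : forall (J : directed_set) (D : direct_system R J)
      (L : lmodType R) (b : forall j, {linear D j -> L})
      (M : lmodType R) (a : forall j, {linear D j -> M}) (aoo : {linear L -> M}),
    is_direct_limit b ->
    (forall j k (h : ds_le j k), a k \o dsys_map D h =1 a j) ->
    (forall j, aoo \o b j =1 a j) ->
    rk _ _ (a j) @[j --> tail_filter J] --> rk _ _ aoo;
  syl_lim_cod : forall (J : directed_set) (D : direct_system R J)
      (L : lmodType R) (b : forall j, {linear D j -> L})
      (M : lmodType R) (a : forall j, {linear M -> D j}) (aoo : {linear M -> L}),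
    is_direct_limit b -> fin_gen M ->
    (forall j k (h : ds_le j k), dsys_map D h \o a j =1 a k) ->
    (forall j, b j \o a j =1 aoo) ->
    rk _ _ (a j) @[j --> tail_filter J] --> rk _ _ aoo;
  syl_coker : forall (M N : lmodType R) (f : {linear M -> N}),
    rk _ _ (idl N) = rk _ _ f + rk _ _ (idl (coker f)) }.

End Sylvester.

Definition pi_star (K : realType) (R S : pzRingType) (pi : {rmorphism R -> S})
    (rkS : map_rank K S) : map_rank K R :=
  fun M N f => rkS _ _ (tens_map pi f).

(* Main.v *)
From HB Require Import structures.
Require Import Defs.
From mathcomp Require Import all_boot all_order all_algebra.
From mathcomp Require Import all_classical all_reals all_analysis.
From mathcomp Require Import freeg.

(* Write C for the cokernel of pi.  If rk C = 0, then the cokernel of every unit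
   map M -> S (x) M, being a quotient of a direct sum of copies of C, has rank
   0; counting ranks along exact sequences then gives rk (S (x) f) = rk f as
   soon as the target of f is finitely generated, and the two continuity axioms
   extend this to all f, so that rk restricted to S-modules is the required
   rank function on S.  Conversely, S (x) C = 0 because pi is an epimorphism;
   for c in C, the vanishing of 1 (x) c already holds in S (x) N for some
   finitely presented N mapping to C, so that R -> N, and hence R -> C, has rank
   0 when (3) holds. *)

Set Implicit Arguments.
Unset Strict Implicit.
Unset Printing Implicit Defensive.

Import Order.TTheory GRing.Theory Num.Theory.

Local Open Scope ring_scope.

(** * Linear maps, submodules and directed unions *)

(** Ranks lie in [0, +oo], so a count along an exact sequence yields an equality only after a finite
    term has been cancelled. Such counts are therefore made for targets of finite rank, and other
    targets are reached as directed unions of finitely generated submodules, whose ranks are finite.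
    Continuity in the target, axiom (5), asks for a finitely generated source, whereas neither S (x)
    R^n nor a finitely generated S-module need be finitely generated over R. This forces the
    reductions to maps out of R^n and the detours through the unit maps M -> S (x) M. The
    epimorphism hypothesis is used in the form s (x) n = 1 (x) s n for n in an S-module, which makes
    the unit and the counit S (x) N -> N mutually inverse. *)

Section Linear.
Variables (R : pzRingType).
Implicit Types M N P Q : lmodType R.

Definition mklin M N (f : M -> N) (fL : linear f) : {linear M -> N} :=
  HB.pack f (GRing.isLinear.Build R M N *:%R f fL).

Lemma lin_ext M N (f g : {linear M -> N}) : f =1 g -> f = g.
Proof.
case: f => f [[f1] [f2]]; case: g => g [[g1] [g2]] /= /funext fg.
subst g; by rewrite (Prop_irrelevance f1 g1) (Prop_irrelevance f2 g2).
Qed.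

Lemma factor_surj M N P (q : {linear M -> N}) (g : {linear M -> P}) :
  (forall y, exists x, q x = y) -> (forall x, q x = 0 -> g x = 0) ->
  exists h : {linear N -> P}, forall x, h (q x) = g x.
Proof.
move=> qS qg; pose s y := projT1 (cid (qS y)).
have sE y : q (s y) = y by rewrite /s; case: cid.
have gq x y : q x = q y -> g x = g y.
  by move=> e; apply/eqP; rewrite -subr_eq0 -linearB qg // linearB e subrr.
have hL : linear (g \o s).
  by move=> a x y /=; rewrite -linearP; apply: gq; rewrite linearP !sE.
by exists (mklin hL) => x; apply: gq; rewrite sE.
Qed.

Lemma coker_piS M N (f : {linear M -> N}) (c : coker f) :
  exists y, coker_pi f y = c.
Proof. by elim/coker_piP: c => y; exists y. Qed.

Section Cyc.
Variables (M : lmodType R) (n : nat) (g : 'I_n -> M).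

Definition rowspan (v : 'rV[R]_n) : M := \sum_i v 0 i *: g i.

Fact rowspan_is_linear : linear rowspan.
Proof.
move=> a x y; rewrite /rowspan scaler_sumr -big_split; apply: eq_bigr => i _.
by rewrite !mxE scalerDl scalerA.
Qed.

HB.instance Definition _ := GRing.isLinear.Build R _ _ *:%R rowspan
  rowspan_is_linear.

Lemma in_span_rowspan x : in_span g x <-> exists v, rowspan v = x.
Proof.
split=> [[c ->]|[v <-]]; last by exists (v 0).
by exists (\row_i c i); apply: eq_bigr => i _; rewrite mxE.
Qed.

Lemma rowspan_delta i : rowspan (delta_mx 0 i) = g i.
Proof.
rewrite /rowspan (bigD1 i) //= mxE !eqxx scale1r big1 ?addr0 // => j ji.
by rewrite mxE (negPf ji) andbF scale0r.
Qed.

End Cyc.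

Lemma row_lin_ext M n (f g : {linear 'rV[R]_n -> M}) :
  (forall i, f (delta_mx 0 i) = g (delta_mx 0 i)) -> f =1 g.
Proof.
move=> fg v; rewrite [v]matrix_sum_delta !linear_sum; apply: eq_bigr => i _.
by rewrite !linear_sum; apply: eq_bigr => j _; rewrite !linearZ /= ord1 fg.
Qed.

Lemma row_lift M N n (q : {linear M -> N}) (f : {linear 'rV[R]_n -> N}) :
  (forall i, exists x, q x = f (delta_mx 0 i)) ->
  exists g : {linear 'rV[R]_n -> M}, forall v, q (g v) = f v.
Proof.
move=> h; pose s i := projT1 (cid (h i)).
have sE i : q (s i) = f (delta_mx 0 i) by rewrite /s; case: cid.
exists (rowspan s : {linear _ -> _}) => v.
suff : q \o (rowspan s) =1 f by apply.
by apply: row_lin_ext => i /=; rewrite rowspan_delta.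
Qed.

Definition cyc_map M (x : M) (r : R^o) : M := (r : R) *: x.

Fact cyc_map_is_linear M (x : M) : linear (cyc_map x).
Proof. by move=> a r s; rewrite /cyc_map scalerDl scalerA. Qed.

HB.instance Definition _ M (x : M) := GRing.isLinear.Build R R^o M *:%R
  (cyc_map x) (cyc_map_is_linear x).

Lemma fin_gen_row n : fin_gen 'rV[R]_n.
Proof.
exists n, (fun i => delta_mx 0 i) => v; exists (v 0).
rewrite {1}[v]matrix_sum_delta big_ord1.
by apply: eq_bigr.
Qed.

End Linear.

Section Submodule.
Variables (R : pzRingType) (M : lmodType R).

Definition is_submod (P : M -> Prop) : Prop :=
  P 0 /\ forall a x y, P x -> P y -> P (a *: x + y).

Section Sub.
Variables (P : M -> Prop) (hP : is_submod P).

Definition submod_pred of is_submod P : {pred M} := [pred x | `[< P x >]].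

Fact submod_predP : submod_closed (submod_pred hP).
Proof.
case: (hP) => P0 PD; split=> [|a x y /asboolP hx /asboolP hy]; apply/asboolP=> //.
exact: PD.
Qed.

HB.instance Definition _ := GRing.isSubmodClosed.Build R M (submod_pred hP)
  (GRing.submod_closed_semi submod_predP).

Definition subm : Type := {x : M | x \in submod_pred hP}.
HB.instance Definition _ := SubChoice.on subm.
HB.instance Definition _ := [SubChoice_isSubLmodule of subm by <:].

Definition subm_mk x (hx : P x) : subm := exist _ x (introT (asboolP _) hx).

Definition subm_val (x : subm) : M := val x.

Fact subm_val_is_linear : linear subm_val.
Proof. by move=> a x y; rewrite /subm_val linearP. Qed.
HB.instance Definition _ := GRing.isLinear.Build R subm M *:%R subm_val
  subm_val_is_linear.

Lemma subm_valP (x : subm) : P (subm_val x).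
Proof. exact/asboolP/(valP x). Qed.

Lemma subm_val_inj : injective subm_val.
Proof. exact: val_inj. Qed.

Lemma subm_lift (N : lmodType R) (f : {linear N -> M}) :
  (forall x, P (f x)) ->
  exists g : {linear N -> subm}, forall x, subm_val (g x) = f x.
Proof.
move=> fP; pose g x := subm_mk (fP x).
have gL : linear g.
  by move=> a x y; apply: subm_val_inj; rewrite linearP /= /subm_val /= linearP.
by exists (mklin gL).
Qed.

End Sub.

Lemma is_submod_im (N : lmodType R) (f : {linear N -> M}) :
  is_submod (fun y => exists x, f x = y).
Proof.
split=> [|a _ _ [x <-] [y <-]]; first by exists 0; rewrite raddf0.
by exists (a *: x + y); rewrite linearP.
Qed.

Lemma is_submod_ker (N : lmodType R) (f : {linear M -> N}) :
  is_submod (fun x => f x = 0).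
Proof.
split=> [|a x y fx fy]; first by rewrite raddf0.
by rewrite linearP fx fy scaler0 addr0.
Qed.

End Submodule.

Section DirectedUnion.
Variables (R : pzRingType) (M : lmodType R) (J : directed_set).
Variables (P : J -> M -> Prop) (hP : forall j, is_submod (P j)).
Hypothesis Pmono : forall j k, ds_le j k -> forall x, P j x -> P k x.

Definition dunion_fun j k (h : ds_le j k) (x : subm (hP j)) : subm (hP k) :=
  subm_mk (hP k) (Pmono h (subm_valP x)).

Fact dunion_fun_is_linear j k (h : ds_le j k) : linear (dunion_fun h).
Proof.
move=> a x y; apply: (@subm_val_inj _ _ _ (hP k)).
by rewrite linearP /= /subm_val /= linearP.
Qed.

Definition dunion : direct_system R J.
Proof.
apply: (@DirectSystem R J (fun j => subm (hP j))
  (fun j k h => mklin (dunion_fun_is_linear h))).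
- by move=> j h x; apply: subm_val_inj.
- by move=> i j k hij hjk hik x; apply: subm_val_inj.
Defined.

Lemma dunion_limit : (forall x, exists j, P j x) ->
  @is_direct_limit R J dunion M (fun j => subm_val (hP := hP j)).
Proof.
move=> Pcov; split=> [j k h x //|T t tc].
(* Any two indices at which x lives have a common upper bound, where the cocone condition identifies
   the two values; the gluing thus does not depend on the index chosen for x. *)
have tE j k x (hj : P j x) (hk : P k x) :
    t j (subm_mk (hP j) hj) = t k (subm_mk (hP k) hk).
  have [l [jl kl]] := ds_ub j k.
  rewrite -(tc _ _ jl) -(tc _ _ kl) /=; congr (t l _).
  exact: (@subm_val_inj _ _ _ (hP l)).
pose c x := projT1 (cid (Pcov x)).
have cP x : P (c x) x by rewrite /c; case: cid.
pose h x := t (c x) (subm_mk (hP _) (cP x)).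
have hE j x (hx : P j x) : h x = t j (subm_mk (hP j) hx) by apply: tE.
have hL : linear h.
  move=> a x y; have [l [jl kl]] := ds_ub (c x) (c y).
  have lx := Pmono jl (cP x); have ly := Pmono kl (cP y).
  have [_ PD] := hP l; rewrite (hE _ _ lx) (hE _ _ ly).
  rewrite (hE _ _ (PD a _ _ lx ly)).
  rewrite -linearP; congr (t l _); apply: (@subm_val_inj _ _ _ (hP l)).
  by rewrite linearP.
exists (mklin hL); split=> [j x|h' h'P x] /=.
  rewrite (hE _ _ (subm_valP x)); congr (t j _).
  exact: (@subm_val_inj _ _ _ (hP j)).
exact: (h'P (c x) (subm_mk (hP _) (cP x))).
Qed.

End DirectedUnion.

Section FinitelyGenerated.
Variables (R : pzRingType) (M : lmodType R).

Definition seq_dset : directed_set.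
Proof.
apply: (@DirectedSet (seq M) (fun s t => {subset s <= t})) => //.
- by move=> s x.
- by move=> s t u st tu x xs; apply/tu/st.
- exact: (inhabits [::]).
- move=> s t; exists (s ++ t); split=> x; rewrite mem_cat => ->; rewrite ?orbT //.
Defined.

(* The span of [s] as the least submodule containing it: this makes it visibly
   monotone in [s] viewed as a finite set. *)
Definition gen_by (s : seq M) (x : M) : Prop :=
  forall P, is_submod P -> (forall y, y \in s -> P y) -> P x.

Lemma is_submod_gen_by s : is_submod (gen_by s).
Proof.
split=> [P [] //|a x y hx hy P hP sP].
by case: (hP) => _; apply; [apply: hx|apply: hy].
Qed.

Lemma gen_by_mono s t : {subset s <= t} -> forall x, gen_by s x -> gen_by t x.
Proof. by move=> st x hx P hP tP; apply: hx => // y /st/tP. Qed.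

Lemma gen_by_mem s x : x \in s -> gen_by s x.
Proof. by move=> xs P _; apply. Qed.

Lemma gen_by_row (s : seq M) :
  exists p : {linear 'rV[R]_(size s) -> subm (is_submod_gen_by s)},
    forall x, exists v, p v = x.
Proof.
pose f : {linear _ -> _} := rowspan (fun i : 'I_(size s) => nth 0 s i).
have [|p pE] := @subm_lift _ _ _ (is_submod_gen_by s) _ f.
  move=> v; rewrite /f /= /rowspan; elim/big_ind: _ => [|x y hx hy|i _].
  - by case: (is_submod_gen_by s).
  - by have [_ h] := is_submod_gen_by s; rewrite -[x in x + y]scale1r; apply: h.
  - have [h0 h] := is_submod_gen_by s; rewrite -[_ *: _]addr0; apply: h => //.
    by apply: gen_by_mem; exact: mem_nth.
exists p => x; have [v vx] : exists v, f v = subm_val x.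
  apply: (subm_valP x _ (is_submod_im f)) => y ys.
  have iy : (index y s < size s)%N by rewrite index_mem.
  by exists (delta_mx 0 (Ordinal iy)); rewrite /f /= rowspan_delta /= nth_index.
by exists v; apply: subm_val_inj; rewrite pE.
Qed.

End FinitelyGenerated.

(** * Rank inequalities *)

Lemma tail_filter_proper (J : directed_set) : ProperFilter (tail_filter J).
Proof.
apply: filter_from_proper => [|j _]; last by exists j; apply: ds_refl.
apply: filter_from_filter => [|i j _ _].
  by have [j] := ds_inh J; exists j.
have [k [ik jk]] := ds_ub i j; exists k => // l kl.
by split; [apply: ds_trans ik _|apply: ds_trans jk _].
Qed.

Lemma near_tail (J : directed_set) (Q : J -> Prop) :
  (forall j, Q j) -> \forall j \near tail_filter J, Q j.
Proof. by move=> h; have [j] := ds_inh J; exists j => // k _; apply: h. Qed.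

Lemma ereal_dense (K : realType) (x y : \bar K) :
  (x < y)%E -> exists2 z, (x < z)%E & (z < y)%E.
Proof.
case: x y => [x||] [y||] //= xy.
- by exists ((x + y) / 2)%:E; rewrite lte_fin midf_lt // -lte_fin.
- by exists (x + 1)%:E; rewrite ?ltry // lte_fin ltrDl.
- by exists (y - 1)%:E; rewrite ?ltNyr // lte_fin gtrBl.
- by exists 0%E; rewrite ?ltNy0 ?lt0y.
Qed.

Lemma tail_lee_cvg (K : realType) (J : directed_set) (f g : J -> \bar K) l l' :
  (f j @[j --> tail_filter J] --> l)%classic ->
  (g j @[j --> tail_filter J] --> l')%classic ->
  (forall j, f j <= g j)%E -> (l <= l')%E.
Proof.
have PF := tail_filter_proper J; move=> fl gl fg; rewrite leNgt; apply/negP.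
move=> /ereal_dense[z lz zl].
have h1 : tail_filter J (fun j => (z < f j)%E).
  exact: (fl _ (open_nbhs_nbhs (conj (@open_ereal_gt_ereal _ z) zl))).
have h2 : tail_filter J (fun j => (g j < z)%E).
  exact: (gl _ (open_nbhs_nbhs (conj (@open_ereal_lt_ereal _ z) lz))).
have [j [/= h3 h4]] := filter_ex (filterI h1 h2).
by have := lt_trans (lt_le_trans h3 (fg j)) h4; rewrite ltxx.
Qed.

Section FgSystem.
Variables (R : pzRingType) (M : lmodType R) (s0 : seq M).

(** Axiom (5) asks for a map into every member of the system, not only into the late ones. The fixed
    list [s0] is put into every member so that a map with image in the span of [s0] factors through
    all of them. *)
Definition fg_sub (s : seq M) := subm (is_submod_gen_by (s0 ++ s)).

Definition fg_system : direct_system R (seq_dset M).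
Proof.
apply: (@dunion R M (seq_dset M) _ (fun s => is_submod_gen_by (s0 ++ s))).
move=> s t st; apply: gen_by_mono => x; rewrite !mem_cat => /orP[->//|/st ->].
exact: orbT.
Defined.

Lemma fg_system_limit :
  @is_direct_limit R _ fg_system M
    (fun s => subm_val (hP := is_submod_gen_by (s0 ++ s))).
Proof.
apply: dunion_limit => x; exists [:: x]; apply: gen_by_mem.
by rewrite mem_cat mem_head orbT.
Qed.

End FgSystem.

Section Rank.
Variables (K : realType) (R : pzRingType) (rk : map_rank K R).
Hypothesis rkS : sylvester rk.
Implicit Types M N P Q : lmodType R.

Local Open Scope ereal_scope.
Local Notation rd M := (rk (idl M)).

Lemma rk_comp_l M N P (f : {linear M -> P}) (g : {linear M -> N})
    (v : {linear N -> P}) : (forall x, f x = v (g x)) -> rk f <= rk g.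
Proof.
move=> h; have -> : f = (v \o g) by apply: lin_ext.
by have := syl_comp rkS g v; rewrite le_min => /andP[].
Qed.

Lemma rk_comp_r M N P (f : {linear M -> P}) (u : {linear M -> N})
    (g : {linear N -> P}) : (forall x, f x = g (u x)) -> rk f <= rk g.
Proof.
move=> h; have -> : f = (g \o u) by apply: lin_ext.
by have := syl_comp rkS u g; rewrite le_min => /andP[].
Qed.

Lemma rk_factor M N M' N' (f : {linear M -> N}) (g : {linear M' -> N'})
    (u : {linear M -> M'}) (v : {linear N' -> N}) :
  (forall x, f x = v (g (u x))) -> rk f <= rk g.
Proof.
move=> h; apply: (@le_trans _ _ (rk (g \o u : {linear _ -> _}))).
  exact: (@rk_comp_l _ _ _ _ _ v).
exact: (@rk_comp_r _ _ _ _ u).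
Qed.

Lemma rk_le_dom M N (f : {linear M -> N}) : rk f <= rd M.
Proof. exact: (@rk_comp_l _ _ _ _ _ f). Qed.

Lemma rk_le_cod M N (f : {linear M -> N}) : rk f <= rd N.
Proof. exact: (@rk_comp_r _ _ _ _ f). Qed.

Lemma rk_eq0 M N (f : {linear M -> N}) : (forall x, f x = 0%R) -> rk f = 0.
Proof.
by move=> f0; rewrite -(syl_0 rkS M N); congr (rk _); apply: lin_ext.
Qed.

(** Axiom (6) speaks of the constructed cokernel only. Any other cokernel [Q] has the same rank,
    since the identity of each factors through that of the other. *)
Lemma rk_exact M N Q (f : {linear M -> N}) (q : {linear N -> Q}) :
  (forall y, exists x, q x = y) -> (forall y, q y = 0%R <-> exists x, f x = y) ->
  rd N = rk f + rd Q.
Proof.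
move=> qS qf; rewrite (syl_coker rkS f); congr (_ + _); apply/eqP.
have [|u uE] := @factor_surj _ _ _ _ (coker_pi f) q (@coker_piS _ _ _ f).
  by move=> x /coker_pi_eq0/qf.
have [|v vE] := @factor_surj _ _ _ _ q (coker_pi f) qS.
  by move=> x /qf/coker_pi_eq0.
rewrite eq_le; apply/andP; split.
  apply: (@rk_factor _ _ _ _ _ _ u v) => c.
  by have [x <-] := coker_piS c; rewrite uE /= vE.
apply: (@rk_factor _ _ _ _ _ _ v u) => y.
by have [x <-] := qS y; rewrite vE /= uE.
Qed.

Lemma rk_coker_surj M N (q : {linear M -> N}) :
  (forall y, exists x, q x = y) -> rd (coker q) = 0.
Proof.
by move=> qS; apply: rk_eq0 => c /=; have [y <-] := coker_piS c; apply/coker_pi_eq0.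
Qed.

Lemma rk_surj M N (q : {linear M -> N}) :
  (forall y, exists x, q x = y) -> rk q = rd N.
Proof. by move=> qS; rewrite (syl_coker rkS q) rk_coker_surj // adde0. Qed.

(** With h = g f, the sequence coker f -> coker h -> coker g -> 0 is exact, so axiom (6) for g and
    for h gives rk g + rd (coker g) = rk h + rk u + rd (coker g), where rk u is at most rd (coker
    f). The last term is finite because it is at most rd P. *)
Lemma rk_precomp_coker M N P (f : {linear M -> N}) (g : {linear N -> P}) :
  rd P < +oo -> rk g <= rk (g \o f) + rd (coker f).
Proof.
move=> Pfin; pose h : {linear M -> P} := g \o f.
have [|u uE] := @factor_surj _ _ _ _ (coker_pi f) (coker_pi h \o g)
    (@coker_piS _ _ _ f).
  by move=> x /coker_pi_eq0[y <-] /=; apply/coker_pi_eq0; exists y.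
have [|v vE] := @factor_surj _ _ _ _ (coker_pi h) (coker_pi g)
    (@coker_piS _ _ _ h).
  by move=> x /coker_pi_eq0[y <-] /=; apply/coker_pi_eq0; exists (f y).
have e : rd (coker h) = rk u + rd (coker g).
  apply: (@rk_exact _ _ _ u v) => [y|y].
    by have [x <-] := coker_piS y; exists (coker_pi h x); rewrite vE.
  have [x <-] := coker_piS y; rewrite vE; split.
    by move=> /coker_pi_eq0[z <-]; exists (coker_pi f z); rewrite uE.
  case=> c; have [z <-] := coker_piS c; rewrite uE /= => /eqP.
  rewrite -subr_eq0 -raddfB => /eqP/coker_pi_eq0[w hw]; apply/coker_pi_eq0.
  by exists (z - f w)%R; rewrite raddfB /= -[g (f w)]/(h w) hw opprB addrC subrK.
have gfin : rd (coker g) \is a fin_num.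
  rewrite ge0_fin_numE ?(syl_ge0 rkS) //; apply: le_lt_trans Pfin.
  by rewrite (syl_coker rkS g) leeDr // (syl_ge0 rkS).
have : rk g + rd (coker g) = rk h + rk u + rd (coker g).
  by rewrite -addeA -e -(syl_coker rkS g) -(syl_coker rkS h).
move=> ge; apply: (@le_trans _ _ (rk h + rk u)).
  by rewrite -(leeD2rE _ _ gfin) ge.
by apply: leeD => //; apply: rk_le_dom.
Qed.

Lemma rk_precomp_surj_fin M N P (q : {linear M -> N}) (g : {linear N -> P}) :
  (forall y, exists x, q x = y) -> rd P < +oo -> rk g <= rk (g \o q).
Proof. by move=> /rk_coker_surj q0 /(rk_precomp_coker q g); rewrite q0 adde0. Qed.

(** A map of full rank on [N] behaves like an injection: rd N = rk g is at most rk (g f) + rd (coker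
    f), and it equals rk f + rd (coker f); the common term is finite. *)
Lemma rk_postcomp_fin M N P (f : {linear M -> N}) (g : {linear N -> P}) :
  rd P < +oo -> rd N < +oo -> rk g = rd N -> rk f <= rk (g \o f).
Proof.
move=> Pfin Nfin gN; have := rk_precomp_coker f g Pfin; rewrite gN.
have cfin : rd (coker f) \is a fin_num.
  rewrite ge0_fin_numE ?(syl_ge0 rkS) //; apply: le_lt_trans Nfin.
  by rewrite (syl_coker rkS f) leeDr // (syl_ge0 rkS).
by rewrite (syl_coker rkS f) leeD2rE.
Qed.

Lemma rk_add M N (f g h : {linear M -> N}) :
  (forall x, h x = f x + g x)%R -> rk h <= rk f + rk g.
Proof.
move=> hE; rewrite -(syl_sum rkS).
have uL : linear (fun x : M => (x, x)) by [].
have vL : linear (fun x : N * N => x.1 + x.2)%R.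
  by move=> a x y /=; rewrite scalerDr addrACA.
exact: (@rk_factor _ _ _ _ _ _ (mklin uL) (mklin vL)).
Qed.

Lemma rk_rowspan M n (g : 'I_n -> M) :
  rk (rowspan g) <= \sum_i rk (cyc_map (g i)).
Proof.
(* Partial sums over a list of indices allow an induction that leaves the domain R^n fixed. *)
pose T (s : seq 'I_n) (v : 'rV[R]_n) : M := (\sum_(i <- s) v 0 i *: g i)%R.
have TL s : linear (T s).
  move=> a x y; rewrite /T scaler_sumr -big_split; apply: eq_bigr => i _.
  by rewrite !mxE scalerDl scalerA.
suff h s : rk (mklin (TL s)) <= \sum_(i <- s) rk (cyc_map (g i)).
  by apply: le_trans (h _); apply: (@rk_comp_r _ _ _ _ idfun).
elim: s => [|i s IHs].
  by rewrite big_nil rk_eq0 // => v; rewrite /= /T big_nil.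
have cL : linear (fun v : 'rV[R]_n => v 0 i : R^o)%R.
  by move=> a x y; rewrite !mxE.
rewrite big_cons; apply: (@le_trans _ _
    (rk (cyc_map (g i) \o mklin cL : {linear _ -> _}) + rk (mklin (TL s)))).
  by apply: rk_add => v; rewrite /= /T big_cons.
by apply: leeD => //; apply: (@rk_comp_r _ _ _ _ (mklin cL)).
Qed.

Lemma rk_row_lty n M (f : {linear 'rV[R]_n -> M}) : rk f < +oo.
Proof.
have -> : f = rowspan (fun i => f (delta_mx 0 i)%R).
  by apply: lin_ext; apply: row_lin_ext => i; rewrite /= rowspan_delta.
apply: le_lt_trans (rk_rowspan _) _.
apply: (@le_lt_trans _ _ (\sum_(i < n) (1 : \bar K))).
  by apply: lee_sum => i _; rewrite -(syl_1 rkS) rk_le_dom.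
by rewrite sumEFin ltry.
Qed.

Lemma rd_row_surj_lty n M (p : {linear 'rV[R]_n -> M}) :
  (forall x, exists v, p v = x) -> rd M < +oo.
Proof. by move=> /rk_surj <-; apply: rk_row_lty. Qed.

Lemma rd_fg_sub_lty M (s0 s : seq M) : rd (fg_sub s0 s) < +oo.
Proof. by have [p] := gen_by_row (s0 ++ s); apply: rd_row_surj_lty. Qed.

Lemma fg_sub_lift M N n (p : {linear 'rV[R]_n -> N}) (i : {linear N -> M}) :
  (forall x, exists v, p v = x) ->
  exists s0 : seq M, forall s, exists a : {linear N -> fg_sub s0 s},
    forall x, subm_val (a x) = i x.
Proof.
move=> pS; exists [seq i (p (delta_mx 0 k)%R) | k <- enum 'I_n] => s.
apply: subm_lift => x; have [v <-] := pS x.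
have [h0 h] := is_submod_gen_by
  ([seq i (p (delta_mx 0 k)%R) | k <- enum 'I_n] ++ s).
rewrite [v]matrix_sum_delta !linear_sum big_ord1 !linear_sum.
elim/big_ind: _ => // [y z hy hz|k _].
  by rewrite -[y]scale1r; apply: h.
rewrite !linearZ /= -[(_ *: _)%R]addr0; apply: h => //; apply: gen_by_mem.
by rewrite mem_cat; apply/orP; left; apply/mapP; exists k; rewrite ?mem_enum.
Qed.

(** Removes the finiteness of the target from [rk_precomp_surj_fin]: [i] factors through all the
    finitely generated submodules of [N] that contain its image, these have finite rank, and axiom
    (5) carries the inequality to the limit for both [i] and [i \o p]. *)
Lemma rk_precomp_row_surj n M N (p : {linear 'rV[R]_n -> M})
    (i : {linear M -> N}) :
  (forall x, exists v, p v = x) -> rk i <= rk (i \o p).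
Proof.
move=> pS; have [s0 ha] := fg_sub_lift i pS; pose a s := projT1 (cid (ha s)).
have aE s x : subm_val (a s x) = i x by rewrite /a; case: cid.
have Mfg : fin_gen M.
  exists n, (fun k => p (delta_mx 0 k)%R) => x; apply/in_span_rowspan.
  have [v <-] := pS x; exists v; apply: row_lin_ext v => k.
  by rewrite /= rowspan_delta.
have PF := tail_filter_proper (seq_dset N).
have aC (j k : seq_dset N) (h : ds_le j k) x :
    dsys_map (fg_system s0) h (a j x) = a k x.
  by apply: subm_val_inj; rewrite aE -(aE j).
have /= l1 := @syl_lim_cod _ _ _ rkS _ (fg_system s0) _ _ _ a i
  (fg_system_limit s0) Mfg aC aE.
have /= l2 := @syl_lim_cod _ _ _ rkS _ (fg_system s0) _ _ _
  (fun s => a s \o p) (i \o p) (fg_system_limit s0) (fin_gen_row R n)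
  (fun j k h v => aC j k h (p v)) (fun s v => aE s (p v)).
apply: tail_lee_cvg l1 l2 _ => s.
exact/rk_precomp_surj_fin/rd_fg_sub_lty.
Qed.

(** By axiom (4), rk f is the limit of the ranks of its restrictions to finitely generated
    submodules, and precomposing such a restriction with a finite free cover does not lower its
    rank. Upper bounds may hence be tested on maps out of R^n. *)
Lemma rk_le_row M N (f : {linear M -> N}) (c : \bar K) :
  (forall n (g : {linear 'rV[R]_n -> M}), rk (f \o g) <= c) -> rk f <= c.
Proof.
move=> h; have PF := tail_filter_proper (seq_dset M).
have /= l := @syl_lim_dom _ _ _ rkS _ (fg_system [::]) _ _ _
  (fun s => f \o subm_val (hP := is_submod_gen_by ([::] ++ s))) f
  (fg_system_limit [::]) (fun j k h => frefl _) (fun j => frefl _).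
apply: cvge_to_le l _; apply: near_tail => s.
have [p pS] := gen_by_row s.
apply: le_trans (rk_precomp_row_surj _ pS) _.
apply: le_trans (h _ (subm_val (hP := is_submod_gen_by s) \o p)).
exact: (@rk_comp_l _ _ _ _ _ idfun).
Qed.

Lemma rk_precomp_surj M N P (q : {linear M -> N}) (g : {linear N -> P}) :
  (forall y, exists x, q x = y) -> rk g <= rk (g \o q).
Proof.
move=> qS; apply: rk_le_row => n f.
have [l lE] := @row_lift _ _ _ _ q f (fun i => qS _).
by apply: (@rk_comp_r _ _ _ _ l) => v /=; rewrite lE.
Qed.

Lemma rk_cyc_eq0 M : (forall x : M, rk (cyc_map x) = 0) -> rd M = 0.
Proof.
move=> h; apply/eqP; rewrite eq_le (syl_ge0 rkS) andbT; apply: rk_le_row => n g.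
apply: (@le_trans _ _ (rk (rowspan (fun i => g (delta_mx 0 i)%R)))).
  apply: (@rk_comp_l _ _ _ _ _ idfun); apply: row_lin_ext => i.
  by rewrite /= rowspan_delta.
by apply: le_trans (rk_rowspan _) _; rewrite big1.
Qed.

End Rank.

(** * Tensor products and direct limits *)

Lemma zmod_morphism0 (U V : zmodType) (f : U -> V) : zmod_morphism f -> f 0 = 0.
Proof. by move=> fB; have := fB 0 0; rewrite !subrr. Qed.

Lemma zmod_morphismD (U V : zmodType) (f : U -> V) : zmod_morphism f ->
  {morph f : x y / x + y}.
Proof.
move=> fB x y; rewrite -{1}[y]opprK -[- y]sub0r !fB (zmod_morphism0 fB).
by rewrite sub0r opprK.
Qed.

Section AddHom.
Variables U V : zmodType.

Definition addhom_pred : {pred U -> V} := [pred f | `[< zmod_morphism f >]].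

Fact addhom_pred_closed : zmod_closed addhom_pred.
Proof.
split=> [|f g /asboolP fB /asboolP gB]; apply/asboolP=> x y.
  by rewrite -[LHS]/0 -[RHS]/(0 - 0) subrr.
rewrite -[LHS]/(f (x - y) - g (x - y)) -[RHS]/(f x - g x - (f y - g y)).
by rewrite fB gB !opprD addrACA.
Qed.

HB.instance Definition _ := GRing.isZmodClosed.Build (U -> V)%type addhom_pred
  addhom_pred_closed.

(** Used twice: with U = V for the endomorphism ring that tests the epimorphism property, and with U
    = S for the coinduced modules that test direct limits. *)
Definition addhom : Type := {f : U -> V | f \in addhom_pred}.
HB.instance Definition _ := SubChoice.on addhom.
HB.instance Definition _ := [SubChoice_isSubZmodule of addhom by <:].

Definition addhom_mk f (fB : zmod_morphism f) : addhom :=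
  exist _ f (introT (asboolP _) fB).

Definition addhom_fun (f : addhom) : U -> V := val f.

Lemma addhom_funB (f : addhom) : zmod_morphism (addhom_fun f).
Proof. exact/asboolP/(valP f). Qed.

Lemma addhom_ext (f g : addhom) : addhom_fun f =1 addhom_fun g -> f = g.
Proof. by move=> /funext; apply: val_inj. Qed.

Lemma addhom_funD (f g : addhom) x :
  addhom_fun (f + g) x = addhom_fun f x + addhom_fun g x.
Proof. by rewrite /addhom_fun raddfD. Qed.

End AddHom.

Section EndRing.
Variable A : zmodType.

Definition endo : Type := addhom A A.
HB.instance Definition _ := GRing.Zmodule.on endo.

Fact endo_id_is_zmod : zmod_morphism (@id A).
Proof. by []. Qed.

Definition endo_one : endo := addhom_mk endo_id_is_zmod.

Fact endo_comp_is_zmod (f g : endo) : zmod_morphism (addhom_fun f \o addhom_fun g).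
Proof. by move=> x y /=; rewrite !addhom_funB. Qed.

Definition endo_mul (f g : endo) : endo := addhom_mk (endo_comp_is_zmod f g).

Fact endo_mulA : associative endo_mul.
Proof. by move=> f g h; apply: addhom_ext. Qed.

Fact endo_mul1 : left_id endo_one endo_mul.
Proof. by move=> f; apply: addhom_ext. Qed.

Fact endo_mulr1 : right_id endo_one endo_mul.
Proof. by move=> f; apply: addhom_ext. Qed.

Fact endo_mulDl : left_distributive endo_mul +%R.
Proof. by move=> f g h; apply: addhom_ext => x; rewrite /= !addhom_funD. Qed.

Fact endo_mulDr : right_distributive endo_mul +%R.
Proof.
move=> f g h; apply: addhom_ext => x.
rewrite addhom_funD -[LHS]/(addhom_fun f (addhom_fun (g + h) x)) addhom_funD.
exact: zmod_morphismD (addhom_funB f) _ _.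
Qed.

HB.instance Definition _ := GRing.Zmodule_isPzRing.Build endo
  endo_mulA endo_mul1 endo_mulr1 endo_mulDl endo_mulDr.

End EndRing.

Section Tensor.
Variables (R S : pzRingType) (pi : {rmorphism R -> S}).
Implicit Types M N P : lmodType R.
Local Notation tens := (tens pi).
Local Notation restr := (restr pi).
Local Notation pure := (pure pi).

Lemma pureBl s s' M (m : M) : pure (s - s') m = pure s m - pure s' m.
Proof. by apply/eqP; rewrite eq_sym subr_eq -pureDl subrK. Qed.

Lemma pureBr s M (m m' : M) : pure s (m - m') = pure s m - pure s m'.
Proof. by apply/eqP; rewrite eq_sym subr_eq -pureDr subrK. Qed.

Section Unit.
Variable M : lmodType R.

Definition tens_unit : M -> restr (tens M) := pure 1.

Fact tens_unit_is_linear : linear tens_unit.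
Proof.
move=> a x y; rewrite /tens_unit pureDr -pureZ mul1r.
by rewrite -[a *: _]/(pi a *: _) pure_scale mulr1.
Qed.

HB.instance Definition _ := GRing.isLinear.Build R M (restr (tens M)) *:%R
  tens_unit tens_unit_is_linear.

End Unit.

Lemma tens_unitE M N (f : {linear M -> N}) x :
  tens_map pi f (tens_unit x) = tens_unit (f x).
Proof. exact: tens_mapE. Qed.

Lemma tens_map_comp M N P (f : {linear M -> N}) (g : {linear N -> P})
    (h : {linear M -> P}) : (forall x, h x = g (f x)) ->
  forall x, tens_map pi h x = tens_map pi g (tens_map pi f x).
Proof.
move=> hE; elim/tens_ind => [|x y hx hy|s m]; first by rewrite !raddf0.
  by rewrite !raddfB /= hx hy.
by rewrite !tens_mapE hE.
Qed.

Lemma tens_map_id M (f : {linear M -> M}) : (forall x, f x = x) ->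
  forall x, tens_map pi f x = x.
Proof.
move=> fE; elim/tens_ind => [|x y hx hy|s m]; first by rewrite !raddf0.
  by rewrite !raddfB /= hx hy.
by rewrite !tens_mapE fE.
Qed.

Lemma pure0 s M : pure s (0 : M) = 0.
Proof. by have := pureBr s (0 : M) 0; rewrite !subrr. Qed.

Lemma tens_map0 M N (f : {linear M -> N}) : (forall x, f x = 0) ->
  forall x, tens_map pi f x = 0.
Proof.
move=> f0; elim/tens_ind => [|x y hx hy|s m]; first by rewrite !raddf0.
  by rewrite !raddfB /= hx hy subrr.
by rewrite !tens_mapE f0 pure0.
Qed.

Lemma tens_map_surj M N (f : {linear M -> N}) : (forall y, exists x, f x = y) ->
  forall y, exists x, tens_map pi f x = y.
Proof.
move=> fS; elim/tens_ind => [|_ _ [x <-] [y <-]|s m].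
- by exists 0; rewrite raddf0.
- by exists (x - y); rewrite raddfB.
- by have [x <-] := fS m; exists (pure s x); rewrite tens_mapE.
Qed.

Lemma tens_exact M N P (f : {linear M -> N}) (q : {linear N -> P}) :
  (forall y, exists x, q x = y) -> (forall y, q y = 0 <-> exists x, f x = y) ->
  forall y, tens_map pi q y = 0 <-> exists x, tens_map pi f x = y.
Proof.
move=> qS qf y; split; last first.
  case=> x <-; elim/tens_ind: x => [|x z hx hz|s m]; first by rewrite !raddf0.
    by rewrite !raddfB /= hx hz subrr.
  rewrite !tens_mapE (_ : q (f m) = 0); last by apply/qf; exists m.
  exact: pure0.
pose l z := projT1 (cid (qS z)).
have lE z : q (l z) = z by rewrite /l; case: cid.
(* The inverse of coker (S (x) f) -> S (x) P. The section [l] is only set-theoretic, but two lifts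
   of z differ by an element of the image of f, so the class is independent of the lift and [b] is
   balanced. *)
pose b s z := coker_pi (tens_map pi f) (pure s (l z)).
have bE s x z : q x = z -> b s z = coker_pi (tens_map pi f) (pure s x).
  move=> qx; apply/eqP; rewrite -subr_eq0 /b -raddfB -pureBr; apply/eqP.
  apply/coker_pi_eq0; have [] := qf (l z - x).
  rewrite linearB lE qx subrr => /(_ erefl)[w <-] _.
  by exists (pure s w); rewrite /= tens_mapE.
have bb : balanced pi b.
  split=> [s s' m|s m m'|s r m].
  - by rewrite /b pureDl raddfD.
  - by rewrite (bE s (l m + l m') (m + m')) ?linearD ?lE // pureDr linearD.
  - by rewrite (bE s (r *: l m) (r *: m)) ?linearZ ?lE //= -pureZ.
have bL : zmod_morphism (tens_lift b) := tens_liftB bb.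
have e x : tens_lift b (tens_map pi q x) = coker_pi (tens_map pi f) x.
  elim/tens_ind: x => [|x z hx hz|s m].
  - by rewrite !raddf0 (zmod_morphism0 bL).
  - by rewrite !raddfB /= bL hx hz.
  - by rewrite tens_mapE tens_liftE // (bE _ m).
by move=> qy; apply/coker_pi_eq0; rewrite -e qy (zmod_morphism0 bL).
Qed.

Lemma row_pair M m1 m2 (h1 : {linear 'rV[R]_m1 -> M})
    (h2 : {linear 'rV[R]_m2 -> M}) :
  exists m (h : {linear 'rV[R]_m -> M}) (i1 : {linear 'rV[R]_m1 -> 'rV[R]_m})
    (i2 : {linear 'rV[R]_m2 -> 'rV[R]_m}),
    (forall v, h1 v = h (i1 v)) /\ (forall v, h2 v = h (i2 v)).
Proof.
have hL : linear (fun v : 'rV[R]_(m1 + m2) => h1 (lsubmx v) + h2 (rsubmx v)).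
  by move=> a x y; rewrite !linearP /= scalerDr addrACA.
have i1L : linear (fun v : 'rV[R]_m1 => row_mx v 0 : 'rV[R]_(m1 + m2)).
  by move=> a x y; rewrite scale_row_mx add_row_mx scaler0 addr0.
have i2L : linear (fun v : 'rV[R]_m2 => row_mx 0 v : 'rV[R]_(m1 + m2)).
  by move=> a x y; rewrite scale_row_mx add_row_mx scaler0 addr0.
exists (m1 + m2)%N, (mklin hL), (mklin i1L), (mklin i2L).
by split=> v /=; rewrite row_mxKl row_mxKr raddf0 ?addr0 ?add0r.
Qed.

(** Each tensor involves finitely many elements of [M]. This lets a map from R^n to S (x) M factor
    through some S (x) R^m. *)
Lemma tens_row_cover M (s : seq (tens M)) :
  exists m (h : {linear 'rV[R]_m -> M}),
    forall t, t \in s -> exists x, tens_map pi h x = t.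
Proof.
have one t : exists m (h : {linear 'rV[R]_m -> M}) x, tens_map pi h x = t.
  elim/tens_ind: t => [|_ _ [m1 [h1 [x <-]]] [m2 [h2 [y <-]]]|a z].
  - by exists 0%N, \0, 0; rewrite raddf0.
  - have [m [h [i1 [i2 [e1 e2]]]]] := row_pair h1 h2.
    exists m, h, (tens_map pi i1 x - tens_map pi i2 y).
    by rewrite raddfB /= -(tens_map_comp e1) -(tens_map_comp e2).
  - exists 1%N, (rowspan (fun=> z)), (pure a (delta_mx 0 0)).
    by rewrite tens_mapE /= rowspan_delta.
elim: s => [|t s [m2 [h2 hs]]]; first by exists 0%N, \0.
have [m1 [h1 [x xt]]] := one t.
have [m [h [i1 [i2 [e1 e2]]]]] := row_pair h1 h2.
exists m, h => u; rewrite inE => /predU1P[->|/hs[y <-]].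
  by exists (tens_map pi i1 x); rewrite -xt -(tens_map_comp e1).
by exists (tens_map pi i2 y); rewrite -(tens_map_comp e2).
Qed.

Section Counit.
Variable N : lmodType S.

Definition tens_counit : tens (restr N) -> N :=
  tens_lift (fun s (n : restr N) => s *: (n : N)).

Fact tens_counit_balanced :
  balanced pi (fun s (n : restr N) => s *: (n : N)).
Proof.
split=> *; rewrite ?scalerDl ?scalerDr //.
by rewrite -scalerA.
Qed.

Lemma tens_counitE s (n : restr N) : tens_counit (pure s n) = s *: (n : N).
Proof. exact/tens_liftE/tens_counit_balanced. Qed.

Fact tens_counit_is_linear : linear tens_counit.
Proof.
have B : zmod_morphism tens_counit := tens_liftB tens_counit_balanced.
have c0 := zmod_morphism0 B.
move=> a x y; rewrite (zmod_morphismD B); congr (_ + _).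
elim/tens_ind: x => [|x z hx hz|s n]; first by rewrite scaler0 c0 scaler0.
  by rewrite scalerBr !B hx hz scalerBr.
by rewrite pure_scale !tens_counitE scalerA.
Qed.

HB.instance Definition _ := GRing.isLinear.Build S (tens (restr N)) N *:%R
  tens_counit tens_counit_is_linear.

(* The action of S on S (x) N (+) N and its conjugate by the unipotent
   (x, n) |-> (x + 1 (x) n, n) agree on R, hence coincide. *)
Lemma epi_pure : ring_epi pi ->
  forall s (n : restr N), pure s n = pure 1 (s *: (n : N) : restr N).
Proof.
move=> epi s n.
pose A : zmodType := (tens (restr N) * restr N)%type.
(* The off-diagonal entry of the conjugated action. The Leibniz rule [dM] is what makes [g]
   multiplicative, and [d] vanishes on the image of R by the balancing relation. *)
pose d (s : S) (n : restr N) := pure s n - pure 1 (s *: (n : N) : restr N).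
have dDl t t' m : d (t + t') m = d t m + d t' m.
  by rewrite /d pureDl scalerDl pureDr opprD addrACA.
have dBl t t' m : d (t - t') m = d t m - d t' m.
  by apply/eqP; rewrite eq_sym subr_eq -dDl subrK.
have dBr t m m' : d t (m - m') = d t m - d t m'.
  by rewrite /d scalerBr !pureBr !opprD addrACA.
have dM t t' m : d (t * t') m = t *: d t' m + d t (t' *: (m : N) : restr N).
  by rewrite /d scalerBr !pure_scale mulr1 addrA subrK scalerA.
pose f0 t (x : A) : A := (t *: x.1, t *: (x.2 : N)).
pose g0 t (x : A) : A := (t *: x.1 + d t x.2, t *: (x.2 : N)).
have f0B t : zmod_morphism (f0 t).
  by move=> x y; rewrite /f0 /= !scalerBr.
have g0B t : zmod_morphism (g0 t).
  by move=> x y; rewrite /g0 /= !scalerBr dBr; congr (_, _); rewrite addrACA -opprD.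
pose f t : endo A := addhom_mk (f0B t); pose g t : endo A := addhom_mk (g0B t).
have fB : zmod_morphism f.
  move=> t t'; apply: addhom_ext => x.
  rewrite /addhom_fun raddfB /= !fctE /f0 !scalerBl //.
have gB : zmod_morphism g.
  move=> t t'; apply: addhom_ext => x.
  rewrite /addhom_fun raddfB /= !fctE /g0 !scalerBl dBl; congr (_, _).
  by rewrite /= addrACA -opprD.
have fM : monoid_morphism f.
  split=> [|t t']; apply: addhom_ext => -[x m].
    by rewrite -[LHS]/(f0 1 (x, m)) /f0 /= !scale1r.
  rewrite -[RHS]/(f0 t (f0 t' (x, m))) -[LHS]/(f0 (t * t') (x, m)) /f0 /=.
  by rewrite !scalerA.
have gM : monoid_morphism g.
  split=> [|t t']; apply: addhom_ext => -[x m].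
    by rewrite -[LHS]/(g0 1 (x, m)) /g0 /= /d !scale1r subrr addr0.
  rewrite -[RHS]/(g0 t (g0 t' (x, m))) -[LHS]/(g0 (t * t') (x, m)) /g0 /=.
  by rewrite scalerDr !scalerA dM addrA.
pose F : {rmorphism S -> endo A} := HB.pack f
  (GRing.isZmodMorphism.Build _ _ f fB) (GRing.isMonoidMorphism.Build _ _ f fM).
pose G : {rmorphism S -> endo A} := HB.pack g
  (GRing.isZmodMorphism.Build _ _ g gB) (GRing.isMonoidMorphism.Build _ _ g gM).
have FG : F \o pi =1 G \o pi.
  move=> r; apply: addhom_ext => -[x m].
  rewrite -[LHS]/(f0 (pi r) (x, m)) -[RHS]/(g0 (pi r) (x, m)) /f0 /g0 /d /=.
  have -> : pure (pi r) m = pure 1 (pi r *: (m : N) : restr N).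
    by rewrite -[pi r in LHS]mul1r pureZ.
  by rewrite subrr addr0.
have /(congr1 (fun h => (addhom_fun h (0, n)).1)) := epi _ _ _ FG s.
by rewrite /addhom_fun /= scaler0 add0r => /esym/eqP; rewrite subr_eq0 => /eqP.
Qed.

End Counit.

Lemma tens_counit_nat (N1 N2 : lmodType S) (f : {linear N1 -> N2}) x :
  tens_counit (@tens_map _ _ pi (restr N1) (restr N2) (restr_map pi f) x) =
    f (tens_counit x).
Proof.
elim/tens_ind: x => [|x y hx hy|s m]; first by rewrite !raddf0.
  by rewrite !raddfB /= hx hy.
by rewrite tens_mapE !tens_counitE linearZ.
Qed.

End Tensor.

(* Hom_Z(S, T) as a left S-module, through the right action of S on itself. *)
Section Coinduced.
Variables (S : pzRingType) (T : zmodType).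

Definition coind : Type := addhom S T.
HB.instance Definition _ := GRing.Zmodule.on coind.

Fact coind_scale_is_zmod (a : S) (f : coind) :
  zmod_morphism (fun s => addhom_fun f (s * a)).
Proof. by move=> s t; rewrite mulrBl addhom_funB. Qed.

Definition coind_scale (a : S) (f : coind) : coind :=
  addhom_mk (coind_scale_is_zmod a f).

Lemma coind_scaleE a f s :
  addhom_fun (coind_scale a f) s = addhom_fun f (s * a).
Proof. by []. Qed.

Fact coind_scaleA a b f :
  coind_scale a (coind_scale b f) = coind_scale (a * b) f.
Proof. by apply: addhom_ext => s; rewrite !coind_scaleE mulrA. Qed.

Fact coind_scale1 : left_id 1 coind_scale.
Proof. by move=> f; apply: addhom_ext => s; rewrite coind_scaleE mulr1. Qed.

Fact coind_scaleDr : right_distributive coind_scale +%R.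
Proof.
by move=> a f g; apply: addhom_ext => s; rewrite coind_scaleE !addhom_funD.
Qed.

Fact coind_scaleDl f : {morph coind_scale^~ f : a b / a + b}.
Proof.
move=> a b; apply: addhom_ext => s; rewrite coind_scaleE addhom_funD.
by rewrite mulrDr (zmod_morphismD (addhom_funB f)).
Qed.

HB.instance Definition _ := GRing.Zmodule_isLmodule.Build S coind
  coind_scaleA coind_scale1 coind_scaleDr coind_scaleDl.

End Coinduced.

(** The images of the [b j] have a submodule as union, by directedness. The quotient map by it and
    the zero map both extend the zero cocone, so uniqueness makes them equal. *)
Lemma direct_limit_surj (R : pzRingType) (J : directed_set)
    (D : direct_system R J) (L : lmodType R) (b : forall j, {linear D j -> L}) :
  is_direct_limit b -> forall x, exists j y, b j y = x.
Proof.
case=> bC bU; pose P x := exists j y, b j y = x.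
have hP : is_submod P.
  split=> [|a _ _ [j [x <-]] [k [y <-]]].
    by have [j] := ds_inh J; exists j, 0; rewrite raddf0.
  have [l [jl kl]] := ds_ub j k.
  exists l, (a *: dsys_map D jl x + dsys_map D kl y).
  by rewrite linearP; congr (_ *: _ + _); [apply: (bC j l)|apply: (bC k l)].
pose q : {linear L -> _} := coker_pi (subm_val (hP := hP)).
have [|h [_ hU]] := bU _ (fun j =>
    \0 : {linear D j -> coker (subm_val (hP := hP))}).
  by [].
have q0 x : q x = 0.
  have -> : q x = h x.
    apply: (hU q) => j y; apply/coker_pi_eq0.
    by exists (subm_mk hP (ex_intro _ j (ex_intro _ y erefl))).
  by apply/esym; apply: (hU \0).
by move=> x; have /coker_pi_eq0[y <-] := q0 x; apply: subm_valP y.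
Qed.

Section LimitPreservation.
Variables (R S : pzRingType) (pi : {rmorphism R -> S}).
Local Notation tens := (tens pi).
Local Notation restr := (restr pi).
Local Notation pure := (pure pi).

Section Restr.
Variables (J : directed_set) (D : direct_system S J).

Definition restr_system : direct_system R J.
Proof.
apply: (@DirectSystem R J (fun j => restr (D j))
  (fun j k h => restr_map pi (dsys_map D h))).
- by move=> j h x; apply: (dsys_id (d := D)).
- by move=> i j k hij hjk hik x; apply: (dsys_comp (d := D) hij hjk hik).
Defined.

(** An R-linear cocone t into [T] becomes an S-linear cocone into Hom_Z(S, T), sending x to s |-> t
    (s x); the map induced on [L] is then evaluated at 1. Working over Z makes this only additive,
    and R-linearity is recovered because every element of [L] comes from some stage. *)
Lemma restr_limit (L : lmodType S) (b : forall j, {linear D j -> L}) :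
  is_direct_limit b ->
  @is_direct_limit R J restr_system (restr L) (fun j => restr_map pi (b j)).
Proof.
move=> bL; have bS := direct_limit_surj bL; case: bL => bC bU.
split=> [j k h x|T t tC]; first exact: (bC j k h).
have uB j (x : D j) : zmod_morphism (fun s : S => t j (s *: x : restr (D j))).
  by move=> s s'; rewrite scalerBl raddfB.
pose u j (x : D j) : coind S T := addhom_mk (uB j x).
have uL j : linear (u j).
  move=> a x y; apply: addhom_ext => s.
  rewrite addhom_funD -[LHS]/(t j (s *: (a *: x + y) : restr (D j))).
  by rewrite scalerDr raddfD scalerA.
have [|h [hE _]] := bU (coind S T) (fun j => mklin (uL j)).
  move=> j k jk x; apply: addhom_ext => s.
  rewrite -[LHS]/(t k (s *: dsys_map D jk x : restr (D k))) -linearZ.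
  exact: (tC j k jk (s *: x)).
pose v (x : restr L) : T := addhom_fun (h x) 1.
have vE j (x : restr (D j)) : v (b j x) = t j x.
  by rewrite /v; have /= -> := hE j x; rewrite /addhom_fun /= scale1r.
have vL : linear v.
  move=> a x y; have -> : v (a *: x + y) = v (a *: x) + v y.
    by rewrite /v raddfD addhom_funD.
  congr (_ + _); have [j [x0 <-]] := bS x.
  have -> : a *: (b j x0 : restr L) = b j (pi a *: x0) by rewrite linearZ.
  by rewrite !vE -[RHS]linearZ.
exists (mklin vL); split=> // w wE x.
by have [j [y <-]] := bS x; rewrite [RHS]vE; apply: wE.
Qed.

End Restr.

Section Tens.
Variables (J : directed_set) (D : direct_system R J).

Definition tens_system : direct_system R J.
Proof.
apply: (@DirectSystem R J (fun j => restr (tens (D j)))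
  (fun j k h => restr_map pi (tens_map pi (dsys_map D h)))).
- by move=> j h; apply: tens_map_id; apply: dsys_id.
- move=> i j k hij hjk hik x /=; rewrite /restr_map; apply/esym.
  by apply: tens_map_comp => y; rewrite -(dsys_comp hij hjk hik).
Defined.

(** Currying: a cocone t on the S (x) D_j gives an R-linear cocone x |-> (s |-> t (s (x) x)) into
    Hom_Z(S, T), and the induced map on [L] is uncurried to the balanced map [c]. R-linearity is
    again checked on elements coming from a stage. *)
Lemma tens_limit (L : lmodType R) (b : forall j, {linear D j -> L}) :
  is_direct_limit b ->
  @is_direct_limit R J tens_system (restr (tens L))
    (fun j => restr_map pi (tens_map pi (b j))).
Proof.
move=> bL; have bS := direct_limit_surj bL; case: bL => bC bU.
split=> [j k h x|T t tC].
  by apply/esym; apply: tens_map_comp => y; rewrite -(bC j k h).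
have uB j (x : D j) : zmod_morphism (fun s : S => t j (pure s x)).
  by move=> s s'; rewrite pureBl raddfB.
pose u j (x : D j) : restr (coind S T) := addhom_mk (uB j x).
have uL j : linear (u j).
  move=> a x y; apply: addhom_ext => s.
  rewrite addhom_funD -[LHS]/(t j (pure s (a *: x + y))).
  by rewrite pureDr raddfD -pureZ.
have [|h [hE _]] := bU (restr (coind S T)) (fun j => mklin (uL j)).
  move=> j k jk x; apply: addhom_ext => s.
  rewrite -[LHS]/(t k (pure s (dsys_map D jk x))) -tens_mapE.
  exact: (tC j k jk (pure s x)).
pose c s x : T := addhom_fun (h x : coind S T) s.
have cE j s x : c s (b j x) = t j (pure s x).
  by rewrite /c; have /= -> := hE j x.
have cb : balanced pi c.
  split=> [s s' x|s x y|s r x].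
  - exact: zmod_morphismD (addhom_funB _) _ _.
  - by rewrite /c raddfD addhom_funD.
  - by rewrite /c linearZ.
pose v : restr (tens L) -> T := tens_lift c.
have vB : zmod_morphism v := tens_liftB cb.
have vE j x : v (tens_map pi (b j) x) = t j x.
  elim/tens_ind: x => [|x y hx hy|s x].
  - by rewrite !raddf0 (zmod_morphism0 vB).
  - by rewrite !raddfB /= vB hx hy.
  - by rewrite tens_mapE /v tens_liftE // cE.
have vL : linear v.
  move=> a x y; rewrite (zmod_morphismD vB); congr (_ + _).
  elim/tens_ind: x => [|x z hx hz|s x].
  - by rewrite scaler0 (zmod_morphism0 vB) scaler0.
  - by rewrite !scalerBr !vB hx hz scalerBr.
  have [j [x0 <-]] := bS x; rewrite -tens_mapE.
  set y0 := pure s x0; set z0 := tens_map pi (b j) y0.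
  have -> : a *: (z0 : restr (tens L)) = tens_map pi (b j) (pi a *: y0).
    by rewrite linearZ.
  by rewrite !vE -[RHS]linearZ.
exists (mklin vL); split=> [j x|w wE]; first exact: vE.
elim/tens_ind => [|x y hx hy|s x]; first by rewrite !raddf0.
  by rewrite !raddfB /= hx hy.
have [j [x0 <-]] := bS x; rewrite -tens_mapE [RHS]vE; exact: wE.
Qed.

End Tens.

End LimitPreservation.

(** * Ranks of tensored maps *)

Section TensorRank.
Variables (K : realType) (R S : pzRingType) (pi : {rmorphism R -> S}).
Variables (rk : map_rank K R) (rkS : sylvester rk).
Implicit Types M N P Q : lmodType R.

Local Open Scope ereal_scope.
Local Notation rd M := (rk (idl M)).
Local Notation rtens M := (restr pi (tens pi M)).

Definition rtens_map M N (f : {linear M -> N}) : {linear rtens M -> rtens N} :=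
  restr_map pi (tens_map pi f).

Definition runit M : {linear M -> rtens M} := tens_unit pi (M := M).

(** Surjections in both directions suffice, as a surjection cannot raise the rank of the identity;
    the two maps need not be shown inverse to each other. *)
Lemma rd_tens_ring : rd (rtens R^o) = rd (restr pi S^o).
Proof.
have pL : linear (fun s : restr pi S^o => pure pi s (1%R : R^o) : rtens R^o).
  move=> a x y; rewrite pureDl; congr (_ + _)%R.
  by rewrite -[RHS]/(pi a *: pure pi x (1%R : R^o))%R pure_scale.
have pS : forall t, exists s, mklin pL s = t.
  elim/tens_ind => [|_ _ [x <-] [y <-]|s r].
  - by exists 0%R; rewrite raddf0.
  - by exists (x - y)%R; rewrite raddfB.
  - by exists (s * pi r)%R; rewrite /= pureZ; congr pure; apply: mulr1.
pose q : {linear rtens R^o -> restr pi S^o} :=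
  restr_map pi (@tens_counit _ _ pi S^o) \o rtens_map (pi_map pi).
have qS : forall s, exists t, q t = s.
  move=> s; exists (pure pi s (1%R : R^o)); rewrite /q /= /restr_map /=.
  by rewrite tens_mapE tens_counitE /pi_map rmorph1; apply: mulr1.
apply: le_anti.
apply/andP; split.
  by rewrite -(rk_surj rkS pS); apply: (rk_le_dom rkS).
by rewrite -(rk_surj rkS qS); apply: (rk_le_dom rkS).
Qed.

Hypothesis C0 : rd (coker (pi_map pi)) = 0.

(** It is enough to treat the cyclic maps, and by subadditivity those at classes of pure tensors.
    For fixed m, the map s |-> s (x) m sends pi r to 1 (x) r m, so it induces C -> coker (runit M),
    and the cyclic map at the class of s (x) m factors through C. *)
Lemma rd_coker_runit M : rd (coker (runit M)) = 0.
Proof.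
apply: (rk_cyc_eq0 rkS) => c; have [t <-] := coker_piS c.
elim/tens_ind: t => [|x y hx hy|s m].
- by apply: (rk_eq0 rkS) => r; rewrite /= /cyc_map raddf0 scaler0.
- apply/eqP; rewrite eq_le (syl_ge0 rkS) andbT -hx -[leRHS]adde0 -hy.
  apply: (@le_trans _ _ (rk (cyc_map (coker_pi (runit M) x)) +
                         rk (cyc_map (- coker_pi (runit M) y)))).
    apply: (rk_add rkS) => r.
    by rewrite /= /cyc_map raddfB scalerDr.
  apply: leeD => //.
  have NL : linear (fun r : R^o => - r : R^o)%R.
    by move=> a u v; rewrite opprD scalerN.
  by apply: (rk_comp_r rkS (u := mklin NL)) => r; rewrite /= /cyc_map scalerN scaleNr.
have gL : linear (fun s : restr pi S^o => coker_pi (runit M) (pure pi s m)).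
  move=> a x y; rewrite pureDl raddfD -linearZ; congr (coker_pi _ _ + _)%R.
  by apply/esym/pure_scale.
have [|h hE] := @factor_surj _ _ _ _ (coker_pi (pi_map pi)) (mklin gL)
   (@coker_piS _ _ _ (pi_map pi)).
  move=> x /coker_pi_eq0[r <-] /=; apply/coker_pi_eq0; exists ((r : R) *: m).
  by rewrite /= /tens_unit -pureZ mul1r.
apply/eqP; rewrite eq_le (syl_ge0 rkS) andbT -C0.
apply: le_trans (rk_le_cod rkS
  (cyc_map (coker_pi (pi_map pi) (s : restr pi S^o)))).
apply: (rk_comp_l rkS (v := h)) => r.
by rewrite /= /cyc_map linearZ hE.
Qed.

Lemma rk_runit M : rk (runit M) = rd (rtens M).
Proof. by rewrite (syl_coker rkS (runit M)) rd_coker_runit adde0. Qed.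

Lemma rk_precomp_runit M N (g : {linear rtens M -> N}) :
  rd N < +oo -> rk g <= rk (g \o runit M).
Proof. by move/(rk_precomp_coker rkS (runit M) g); rewrite rd_coker_runit adde0. Qed.

(** Finiteness is kept together with the equality because the closure properties below cancel ranks.
    They make every finitely generated module stable once rk S = 1. *)
Definition tens_stable M := rd M < +oo /\ rd (rtens M) = rd M.

Lemma rk_postcomp_runit M N (f : {linear M -> N}) :
  tens_stable N -> rk f <= rk (runit N \o f).
Proof.
case=> Nfin Neq; apply: (rk_postcomp_fin rkS) => //; first by rewrite Neq.
by rewrite rk_runit.
Qed.

Lemma rk_runit_comp M N (f : {linear M -> N}) :
  rk (runit N \o f) = rk (rtens_map f \o runit M).
Proof. by congr (rk _); apply: lin_ext => x; rewrite /= tens_unitE. Qed.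

(** By naturality the unit of [N] after f equals S (x) f after the unit of [M]. With a stable
    target, neither the unit of [N] placed after f nor the unit of [M] placed before S (x) f lowers
    the rank. *)
Lemma rk_tens_stable M N (f : {linear M -> N}) :
  tens_stable N -> rk (rtens_map f) = rk f.
Proof.
move=> Nst; have [Nfin Neq] := Nst; apply/eqP; rewrite eq_le; apply/andP; split.
  apply: le_trans (rk_precomp_runit _ _) _; first by rewrite Neq.
  by rewrite -rk_runit_comp; apply: (rk_comp_l rkS (v := runit N)).
apply: le_trans (rk_postcomp_runit _ Nst) _.
by rewrite rk_runit_comp; apply: (rk_comp_r rkS (u := runit M)).
Qed.

(** Let i be the inclusion of ker q. Right exactness gives rd M = rk i + rd N and the same after
    tensoring; rk (S (x) i) = rk i since only the target [M] of i has to be stable, whatever the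
    kernel is. *)
Lemma tens_stable_surj M N (q : {linear M -> N}) :
  (forall y, exists x, q x = y) -> tens_stable M -> tens_stable N.
Proof.
move=> qS Mst; have [Mfin Meq] := Mst.
pose i : {linear _ -> M} := subm_val (hP := is_submod_ker q).
have qi y : q y = 0%R <-> exists x, i x = y.
  split=> [qy|[x <-]]; first by exists (subm_mk (is_submod_ker q) qy).
  exact: subm_valP x.
have e1 := rk_exact rkS qS qi.
have e2 : rd (rtens M) = rk (rtens_map i) + rd (rtens N).
  by apply: (@rk_exact _ _ _ rkS _ _ _ (rtens_map i) (rtens_map q));
    [apply: tens_map_surj|apply: tens_exact].
have ifin : rk i \is a fin_num.
  rewrite ge0_fin_numE ?(syl_ge0 rkS) //.
  exact: le_lt_trans (rk_le_cod rkS i) Mfin.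
split; first by rewrite -(rk_surj rkS qS); apply: le_lt_trans (rk_le_dom rkS q) Mfin.
move: e2; rewrite Meq e1 rk_tens_stable // => e.
apply: le_anti; rewrite -[X in X && _](leeD2lE _ _ ifin).
by rewrite -[X in _ && X](leeD2lE _ _ ifin) -e lexx.
Qed.

Lemma rd_prod M N : rd (M * N)%type = rd M + rd N.
Proof.
by rewrite -(syl_sum rkS); congr (rk _); apply: lin_ext => -[x y].
Qed.

Lemma tens_stable_prod M N :
  tens_stable M -> tens_stable N -> tens_stable (M * N)%type.
Proof.
case=> Mfin Meq [Nfin Neq]; split; first by rewrite rd_prod lte_add_pinfty.
rewrite rd_prod -Meq -Neq -rd_prod.
have fL : linear (fun z : M * N => z.1) by [].
have sL : linear (fun z : M * N => z.2) by [].
have lL : linear (fun x : M => (x, 0%R) : M * N).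
  by move=> a x y; rewrite -[RHS]/(_, _) /= scaler0 addr0.
have rL : linear (fun y : N => (0%R, y) : M * N).
  by move=> a x y; rewrite -[RHS]/(_, _) /= scaler0 addr0.
pose f := rtens_map (mklin fL); pose s := rtens_map (mklin sL).
pose l := rtens_map (mklin lL); pose r := rtens_map (mklin rL).
have uL : linear (fun z : rtens (M * N)%type => (f z, s z)).
  by move=> a x y; rewrite !linearP.
have vL : linear (fun z : rtens M * rtens N => l z.1 + r z.2)%R.
  by move=> a x y; rewrite !linearP /= scalerDr addrACA.
apply/eqP; rewrite eq_le; apply/andP; split.
  apply: (rk_factor rkS (u := mklin uL) (v := mklin vL)) => /=.
  elim/tens_ind => [|x y hx hy|t [m n]]; first by rewrite !raddf0 addr0.
    by rewrite !raddfB /= addrACA -opprD; congr (_ - _)%R.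
  rewrite /f /s /l /r /= /restr_map !tens_mapE /= -pureDr.
  by congr (pure _ _ (_, _)); rewrite ?addr0 ?add0r.
have fl z : f (l z) = z.
  rewrite -[RHS](@tens_map_id _ _ pi _ idfun) //.
  by apply/esym; apply: tens_map_comp.
have sr z : s (r z) = z.
  rewrite -[RHS](@tens_map_id _ _ pi _ idfun) //.
  by apply/esym; apply: tens_map_comp.
have fr z : f (r z) = 0%R.
  rewrite -(@tens_map0 _ _ pi N M \0 _ z) //.
  by apply/esym; apply: tens_map_comp.
have sl z : s (l z) = 0%R.
  rewrite -(@tens_map0 _ _ pi M N \0 _ z) //.
  by apply/esym; apply: tens_map_comp.
apply: (rk_factor rkS (u := mklin vL) (v := mklin uL)) => -[x y] /=.
by rewrite !raddfD /= fl sr fr sl addr0 add0r.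
Qed.

Hypothesis S1 : rd (restr pi S^o) = 1.

Lemma tens_stable_ring : tens_stable R^o.
Proof. by rewrite /tens_stable rd_tens_ring S1 (syl_1 rkS) ltry. Qed.

Lemma tens_stable_row n : tens_stable 'rV[R]_n.
Proof.
elim: n => [|n IHn].
  apply: (@tens_stable_surj R^o _ \0); last exact: tens_stable_ring.
  by move=> y; exists 0%R; rewrite [y]thinmx0.
have qL : linear (fun z : R^o * 'rV[R]_n =>
    row_mx (z.1 : R)%:M z.2 : 'rV[R]_(1 + n))%R.
  by move=> a x y /=; rewrite scale_row_mx add_row_mx scale_scalar_mx raddfD.
apply: (@tens_stable_surj _ _ (mklin qL)); last first.
  exact: tens_stable_prod tens_stable_ring IHn.
move=> y; exists ((lsubmx (y : 'rV_(1 + n)) 0 0)%R, rsubmx (y : 'rV_(1 + n))).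
by rewrite /= -mx11_scalar hsubmxK.
Qed.

Lemma tens_stable_row_surj n M (p : {linear 'rV[R]_n -> M}) :
  (forall x, exists v, p v = x) -> tens_stable M.
Proof. by move=> pS; apply: tens_stable_surj pS (tens_stable_row n). Qed.

Lemma tens_stable_fg_sub M (s0 s : seq M) : tens_stable (fg_sub s0 s).
Proof. by have [p] := gen_by_row (s0 ++ s); apply: tens_stable_row_surj. Qed.

Lemma rk_tens_row n M (f : {linear 'rV[R]_n -> M}) : rk (rtens_map f) = rk f.
Proof.
have idS (v : 'rV[R]_n) : exists w, (idfun : {linear _ -> _}) w = v by exists v.
have [s0 ha] := fg_sub_lift f idS; pose a s := projT1 (cid (ha s)).
have aE s x : subm_val (a s x) = f x by rewrite /a; case: cid.
have aC (j k : seq_dset M) (h : ds_le j k) x :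
    dsys_map (fg_system s0) h (a j x) = a k x.
  by apply: subm_val_inj; rewrite aE -(aE j).
have PF := tail_filter_proper (seq_dset M).
have fg := fin_gen_row R n.
apply: le_anti; apply/andP; split.
  (* Upper bound: S (x) f factors through each S (x) a_s, whose rank is that of a_s because its
     target is stable; rk f is the limit of these. *)
  have /= l := @syl_lim_cod _ _ _ rkS _ (fg_system s0) _ _ _ a f
    (fg_system_limit s0) fg aC aE.
  apply: cvge_to_ge l _; apply: near_tail => s.
  rewrite -(rk_tens_stable _ (tens_stable_fg_sub s0 s)).
  pose i : {linear fg_sub s0 s -> M} :=
    subm_val (hP := is_submod_gen_by (s0 ++ s)).
  apply: (rk_comp_l rkS (v := rtens_map i)).
  by apply: tens_map_comp => x; rewrite -(aE s).
apply: (@le_trans _ _ (rk (runit M \o f))); last first.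
  by rewrite rk_runit_comp; apply: (rk_comp_r rkS (u := runit _)).
have /= l := @syl_lim_cod _ _ _ rkS _ (tens_system pi (fg_system s0)) _ _ _
  (fun s => runit (fg_sub s0 s) \o a s) (runit M \o f)
  (tens_limit pi (fg_system_limit s0)) fg.
apply: cvge_to_ge (l _ _) _.
- move=> j k h x; rewrite /= /restr_map tens_unitE; congr tens_unit.
  exact: aC.
- by move=> j x; rewrite /= /restr_map tens_unitE; congr tens_unit; apply: aE.
apply: near_tail => s.
apply: le_trans (rk_postcomp_runit (a s) (tens_stable_fg_sub s0 s)).
apply: (rk_comp_l rkS (v := subm_val (hP := is_submod_gen_by (s0 ++ s)))) => x.
exact/esym/aE.
Qed.

Lemma rk_tens M N (f : {linear M -> N}) : rk (rtens_map f) = rk f.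
Proof.
apply: le_anti; apply/andP; split; apply: (rk_le_row rkS) => n g; last first.
  rewrite -rk_tens_row; apply: (rk_comp_r rkS (u := rtens_map g)).
  by apply: tens_map_comp.
(* The map [g] goes from R^n into S (x) M. The images of the basis lie in the image of some S (x) h
   with h : R^m -> M, so S (x) f after [g] factors through S (x) (f h), which [rk_tens_row]
   handles. *)
have [m [h hs]] := tens_row_cover
  [seq g (delta_mx 0 i)%R : tens pi M | i <- enum 'I_n].
have hE i : exists x, rtens_map h x = g (delta_mx 0 i)%R.
  by apply: hs; apply/mapP; exists i; rewrite ?mem_enum.
have [l lE] := row_lift hE.
apply: (@le_trans _ _ (rk (rtens_map (f \o h : {linear _ -> _})))).
  apply: (rk_comp_r rkS (u := l)) => v; rewrite [LHS]/= -lE; apply/esym.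
  exact: tens_map_comp.
by rewrite rk_tens_row; apply: (rk_comp_r rkS (u := h)).
Qed.

End TensorRank.

(** * Finite presentation *)

Section FinitePresentation.
Variable R : pzRingType.
Implicit Types M N : lmodType R.

Lemma fin_pres_ring : fin_pres (R^o : lmodType R).
Proof.
have pL : linear (fun v : 'rV[R]_1 => v 0 0 : R^o) by move=> a x y; rewrite !mxE.
exists 1%N, (mklin pL); split=> [x|].
  by exists (x : R)%:M; rewrite /= mxE mulr1n.
exists 0%N, (fun=> 0) => v /=; split=> [v0|[c ->]]; last by rewrite big_ord0 mxE.
by exists (fun=> 0); rewrite big_ord0 [v]mx11_scalar v0 raddf0.
Qed.

Lemma fin_pres_coker_rowspan n m (k : 'I_m -> 'rV[R]_n) :
  fin_pres (coker (rowspan k)).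
Proof.
exists n, (coker_pi (rowspan k)); split; first exact: coker_piS.
exists m, k => v; split=> [/coker_pi_eq0[u uv]|/in_span_rowspan[u uv]].
  by apply/in_span_rowspan; exists u.
by apply/coker_pi_eq0; exists u.
Qed.

Lemma fin_pres_coker_cyc N (x : N) : fin_pres N -> fin_pres (coker (cyc_map x)).
Proof.
case=> n [p [pS [m [k kP]]]]; have [w wx] := pS x.
exists n, (coker_pi (cyc_map x) \o p); split.
  move=> c; have [y <-] := coker_piS c; have [v <-] := pS y.
  by exists v.
(* One extra relation, in position 0: the lift [w] of x. *)
exists m.+1, (fun i => oapp k w (unlift ord0 i)) => v; split.
  case/coker_pi_eq0 => r rv; have [] := kP (v - (r : R) *: w).
  rewrite linearB linearZ /= wx -rv subrr => /(_ erefl)[c cE] _.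
  exists (fun i => oapp c r (unlift ord0 i)); rewrite big_ord_recl unlift_none /=.
  rewrite -[LHS](subrK ((r : R) *: w)) addrC cE; congr (_ + _).
  by apply: eq_bigr => i _; rewrite liftK.
case=> c ->; rewrite big_ord_recl unlift_none /= linearD linearZ /= wx.
have -> : p (\sum_(i < m) c (fintype.lift ord0 i) *:
    oapp k w (unlift ord0 (fintype.lift ord0 i))) = 0.
  apply/kP; exists (fun i => c (fintype.lift ord0 i)).
  by apply: eq_bigr => i _; rewrite liftK.
by rewrite addr0; apply/coker_pi_eq0; exists (c ord0).
Qed.

End FinitePresentation.

Section FiniteReason.
Variables (R S : pzRingType) (pi : {rmorphism R -> S}) (M : lmodType R).

(* A relation of S (x) M uses the linear structure of M in finitely many places
   only, so it survives along any map that is linear in these places. *)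
Lemma tens_rel_finite x : tens_rel pi (M := M) x ->
  exists L : seq (R * M * M), forall (N : lmodType R) (phi : M -> N),
    (forall t, t \in L ->
      phi (t.1.1 *: t.1.2 + t.2) = t.1.1 *: phi t.1.2 + phi t.2) ->
    tens_lift0 (fun s m => pure pi s (phi m)) x = 0.
Proof.
elim=> [|{}x y _ [L1 h1] _ [L2 h2]|s s' m|s m m'|s r m].
- by exists [::] => N phi _; rewrite raddf0.
- exists (L1 ++ L2) => N phi hL; rewrite raddfB /= h1 ?h2 ?subrr // => t tL;
    by apply: hL; rewrite mem_cat tL ?orbT.
- exists [::] => N phi _.
  by rewrite !raddfB /= !tens_lift0_gen pureDl -addrA -opprD subrr.
- exists [:: (1, m, m')] => N phi /(_ _ (mem_head _ _)) /=.
  rewrite !scale1r => e.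
  by rewrite !raddfB /= !tens_lift0_gen e pureDr -addrA -opprD subrr.
(* The triple (1, 0, 0) forces phi 0 = 0, without which (r, m, 0) would not say that phi (r m) = r
   phi m. *)
- exists [:: (1, 0, 0); (r, m, 0)] => N phi hL.
  have := hL _ (mem_head _ _); rewrite /= !scale1r addr0 => e0.
  have phi0 : phi 0 = 0 by apply: (addrI (phi 0)); rewrite -e0 addr0.
  have := hL (r, m, 0); rewrite !inE eqxx orbT => /(_ erefl) /=.
  rewrite phi0 !addr0 => e.
  by rewrite raddfB /= !tens_lift0_gen e -pureZ subrr.
Qed.

(** [N] has a generator for each element of [M] involved in a derivation of s (x) c = 0 and a
    relation for each linearity used in it. Sending these elements to their generators is then
    linear where needed, so the derivation can be replayed in S (x) N. *)
Lemma pure_eq0_fin_pres s (c : M) : pure pi s c = 0 ->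
  exists (N : lmodType R) (x : N) (h : {linear N -> M}),
    [/\ fin_pres N, h x = c & pure pi s x = 0].
Proof.
move=> sc0; have : tens_rel pi << (s, c) >>.
  have : pure pi s c = tens_pi pi 0 by rewrite sc0 raddf0.
  by move=> /quot_eqP; rewrite subr0 => /asboolP.
case/tens_rel_finite => L hL.
pose X := c :: flatten [seq [:: t.1.2; t.2; t.1.1 *: t.1.2 + t.2] | t <- L].
pose n := size X.
(* A total function, as [tens_rel_finite] requires: for m outside [X] the index is n and the row is
   0. *)
pose e (m : M) : 'rV[R]_n := \row_(i < n) (i == index m X :> nat)%:R.
pose h0 : {linear 'rV[R]_n -> M} := rowspan (fun i : 'I_n => nth 0 X i).
have he m : m \in X -> h0 (e m) = m.
  move=> mX; have iX : (index m X < n)%N by rewrite index_mem.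
  have -> : e m = delta_mx 0 (Ordinal iX).
    by apply/rowP => i; rewrite !mxE eqxx.
  by rewrite /h0 /= rowspan_delta /= nth_index.
have LX t : t \in L ->
    [/\ t.1.2 \in X, t.2 \in X & t.1.1 *: t.1.2 + t.2 \in X].
  move=> tL.
  have sub y : y \in [:: t.1.2; t.2; t.1.1 *: t.1.2 + t.2] -> y \in X.
    by move=> yt; rewrite inE; apply/orP; right; apply/flatten_mapP; exists t.
  by split; apply: sub; rewrite !inE eqxx ?orbT.
pose kt (t : R * M * M) : 'rV[R]_n :=
  e (t.1.1 *: t.1.2 + t.2) - (t.1.1 *: e t.1.2 + e t.2).
pose k (i : 'I_(size L)) := kt (tnth (in_tuple L) i).
pose q : {linear 'rV[R]_n -> coker (rowspan k)} := coker_pi (rowspan k).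
have [|h hE] := @factor_surj _ _ _ _ q h0 (@coker_piS _ _ _ _).
  move=> x /coker_pi_eq0[v <-] /=.
  rewrite [rowspan k v]/rowspan linear_sum big1 // => i _.
  have [x1 x2 x3] := LX _ (mem_tnth i (in_tuple L)).
  by rewrite linearZ /k /kt linearB linearD linearZ /= !he // subrr scaler0.
exists (coker (rowspan k)), (q (e c)), h; split.
- exact: fin_pres_coker_rowspan.
- by rewrite hE he // mem_head.
have := hL _ (fun m => q (e m)); rewrite tens_lift0_gen; apply=> t tL.
have /tnthP[i ti] : t \in in_tuple L by [].
rewrite -linearZ -linearD; apply/eqP; rewrite -subr_eq0 -linearB; apply/eqP.
apply/coker_pi_eq0; exists (delta_mx 0 i); rewrite /= rowspan_delta /k /kt ti //.
Qed.

End FiniteReason.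

(** * The four conditions *)

Section Restriction.
Variables (K : realType) (R S : pzRingType) (pi : {rmorphism R -> S}).
Variables (rk : map_rank K R) (rkS : sylvester rk).

Local Open Scope ereal_scope.
Local Notation rd M := (rk (idl M)).
Local Notation rmap f := (restr_map pi f : {linear restr pi _ -> restr pi _}).

Definition restr_rank : map_rank K S := fun M N f => rk (rmap f).

Hypothesis rk_tens_map : forall (M N : lmodType R) (f : {linear M -> N}),
  rk (rtens_map pi f) = rk f.

(** The R-span of S-generators loses no rank: they give a surjection S (x) R^n -> M, f after it
    equals the counit after S (x) (f h) for h : R^n -> M, and tensoring preserves the rank of f
    h. *)
Lemma rk_restr_gen (M N : lmodType S) (f : {linear M -> N}) n (g : 'I_n -> M) :
  (forall x, in_span g x) ->
  rk (rmap f) =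
    rk (rmap f \o rowspan (g : 'I_n -> restr pi M)).
Proof.
move=> gS.
pose h : {linear 'rV[R]_n -> restr pi M} := rowspan (g : 'I_n -> restr pi M).
apply: le_anti; apply/andP; split; last exact: (rk_comp_r rkS (u := h)).
pose p : {linear restr pi (tens pi 'rV[R]_n) -> restr pi M} :=
  rmap (@tens_counit _ _ pi M) \o rtens_map pi h.
have pE s i : p (pure pi s (delta_mx 0 i)%R) = (s *: g i)%R.
  rewrite /p /= /restr_map /= tens_mapE tens_counitE.
  by rewrite /h /= rowspan_delta.
have pS x : exists t, p t = x.
  have [c ->] := gS x; exists (\sum_i pure pi (c i) (delta_mx 0 i)%R)%R.
  by rewrite raddf_sum; apply: eq_bigr => i _; apply: pE.
apply: le_trans (rk_precomp_surj rkS (rmap f) pS) _.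
rewrite -[leRHS]rk_tens_map.
apply: (rk_comp_l rkS (v := rmap (@tens_counit _ _ pi N))) => x.
have e : tens_map pi (rmap f \o h) x = tens_map pi (rmap f) (tens_map pi h x).
  exact: tens_map_comp.
exact: etrans (esym (tens_counit_nat f _))
  (congr1 (@tens_counit _ _ pi N) (esym e)).
Qed.

Lemma sylvester_restr : rd (restr pi S^o) = 1 -> sylvester restr_rank.
Proof.
move=> S1; split.
- by move=> M N f; apply: (syl_ge0 rkS).
- by move=> M N; apply: (rk_eq0 rkS).
- by rewrite -S1; congr (rk _); apply: lin_ext.
- move=> M N P f g; have -> : restr_rank (g \o f) =
      rk (rmap g \o rmap f : {linear _ -> _}).
    by congr (rk _); apply: lin_ext.
  exact: (syl_comp rkS).
- move=> M1 N1 M2 N2 f g; rewrite /restr_rank -(syl_sum rkS).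
  (* Restriction of a product and product of restrictions have the same elements and the same
     action, but are different module structures to Rocq; the identity is linear both ways. *)
  have uL : linear (fun x : restr pi (M1 * M2)%type =>
      x : (restr pi M1 * restr pi M2)%type) by [].
  have u'L : linear (fun x : restr pi M1 * restr pi M2 =>
      x : restr pi (M1 * M2)%type) by [].
  have vL : linear (fun x : restr pi (N1 * N2)%type =>
      x : (restr pi N1 * restr pi N2)%type) by [].
  have v'L : linear (fun x : restr pi N1 * restr pi N2 =>
      x : restr pi (N1 * N2)%type) by [].
  apply: le_anti; apply/andP; split.
    exact: (rk_factor rkS (u := mklin uL) (v := mklin v'L)).
  exact: (rk_factor rkS (u := mklin u'L) (v := mklin vL)).
- move=> J D L b M a aoo bL aC aE.
  exact: (@syl_lim_dom _ _ _ rkS _ (restr_system pi D) _ _ _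
    (fun j => rmap (a j)) (rmap aoo) (restr_limit pi bL)).
- move=> J D L b M a aoo bL [n [g gS]] aC aE.
  (* [M] is finitely generated over S only, so axiom (5) over R is applied to R^n in its place. *)
  rewrite /restr_rank (rk_restr_gen aoo gS).
  have -> : (fun j => rk (rmap (a j))) = (fun j =>
      rk (rmap (a j) \o rowspan (g : 'I_n -> restr pi M))).
    by apply/funext => j; apply: rk_restr_gen.
  apply: (@syl_lim_cod _ _ _ rkS _ (restr_system pi D) _ _ _
    (fun j => rmap (a j) \o rowspan (g : 'I_n -> restr pi M))
    (rmap aoo \o rowspan (g : 'I_n -> restr pi M)) (restr_limit pi bL)).
  + exact: fin_gen_row.
  + by move=> j k h x; apply: (aC j k h).
  + by move=> j x; apply: (aE j).
- move=> M N f.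
  have qS (y : restr pi (coker f)) : exists x, rmap (coker_pi f) x = y.
    by have [x xy] := @coker_piS _ _ _ f y; exists x.
  have qf y : rmap (coker_pi f) y = 0%R <-> exists x, rmap f x = y.
    exact: (@coker_pi_eq0 _ _ _ f y).
  have := rk_exact rkS qS qf; rewrite /restr_rank => e.
  have idE (P : lmodType S) : rk (rmap (idl P)) = rd (restr pi P).
    by congr (rk _); apply: lin_ext.
  by rewrite !idE.
Qed.

End Restriction.

Section Equivalences.
Variables (K : realType) (R S : pzRingType) (pi : {rmorphism R -> S}).
Hypothesis pi_epi : ring_epi pi.

Local Open Scope ereal_scope.

Lemma tens_unit_counit (N : lmodType S) (x : tens pi (restr pi N)) :
  tens_unit pi (tens_counit x : restr pi N) = x.
Proof.
elim/tens_ind: x => [|x y hx hy|s n]; first by rewrite !raddf0.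
  by rewrite !raddfB /= hx hy.
by rewrite tens_counitE /tens_unit -(epi_pure pi_epi).
Qed.

Lemma tens_counit_unit (N : lmodType S) (n : restr pi N) :
  tens_counit (tens_unit pi n) = n.
Proof. by rewrite tens_counitE scale1r. Qed.

Lemma pi_star_rtens (rkS : map_rank K S) (M N : lmodType R) (f : {linear M -> N}) :
  sylvester rkS -> pi_star pi rkS (rtens_map pi f) = pi_star pi rkS f.
Proof.
move=> Ssyl; rewrite /pi_star.
(* The unit is R-linear by construction; it is S-linear here as the inverse of the S-linear
   counit. *)
have uL (P : lmodType S) : linear (fun x : P => tens_unit pi (x : restr pi P)).
  move=> a x y; rewrite -[RHS]tens_unit_counit; congr tens_unit.
  by rewrite linearP /= !tens_counit_unit.
apply: le_anti; apply/andP; split.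
  apply: (rk_factor Ssyl (u := @tens_counit _ _ pi (tens pi M))
    (v := mklin (uL (tens pi N)))) => x.
  rewrite -[RHS]/(tens_unit pi
    (tens_map pi f (tens_counit x) : restr pi (tens pi N))).
  by rewrite -tens_counit_nat tens_unit_counit.
apply: (rk_factor Ssyl (u := mklin (uL (tens pi M)))
  (v := @tens_counit _ _ pi (tens pi N))) => x.
have := tens_counit_nat (tens_map pi f) (tens_unit pi (x : restr pi (tens pi M))).
by rewrite tens_counit_unit.
Qed.

(** In S (x) S one has 1 (x) s = s (x) 1, and the class of 1 in the cokernel is 0. *)
Lemma pure1_coker_pi_map (c : coker (pi_map pi)) : pure pi 1%R c = 0%R.
Proof.
have [s <-] := coker_piS c.
pose q : {linear restr pi S^o -> coker (pi_map pi)} := coker_pi (pi_map pi).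
have e : pure pi 1%R (s : restr pi S^o) = pure pi s (1%R : restr pi S^o).
  by rewrite (epi_pure (N := S^o) pi_epi s); congr pure; apply/esym/mulr1.
have := congr1 (tens_map pi q) e; rewrite !tens_mapE => ->.
rewrite (_ : q 1%R = 0%R) ?pure0 //.
by apply/coker_pi_eq0; exists 1%R; rewrite /= /pi_map rmorph1.
Qed.

Variables (rk : map_rank K R) (rkS : sylvester rk).
Local Notation rd M := (rk (idl M)).
Hypothesis rk_fin_pres : forall M : lmodType R, fin_pres M ->
  rd (restr pi (tens pi M)) = rd M.

(** Since 1 (x) x = 0, tensoring kills f = [cyc_map x], so S (x) N and S (x) coker f have the same
    rank. Both [N] and coker f are finitely presented, hence rd N = rd (coker f), and axiom (6)
    leaves rk f = 0 as these ranks are finite. *)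
Lemma rk_cyc_fin_pres (N : lmodType R) (x : N) :
  fin_pres N -> pure pi 1%R x = 0%R -> rk (cyc_map x) = 0.
Proof.
move=> Npres x0; have [n [p [pS _]]] := Npres.
have Nfin : rd N < +oo by apply: (rd_row_surj_lty rkS) pS.
pose f : {linear R^o -> N} := cyc_map x.
pose q : {linear N -> coker f} := coker_pi f.
have f0 t : tens_map pi f t = 0%R.
  elim/tens_ind: t => [|t t' ht ht'|s r]; first by rewrite raddf0.
    by rewrite raddfB /= ht ht' subrr.
  rewrite tens_mapE /= /cyc_map -pureZ -[(s * _)%R]mulr1 -pure_scale x0.
  exact: scaler0.
have e : rd (restr pi (tens pi N)) =
    rk (rtens_map pi f) + rd (restr pi (tens pi (coker f))).
  apply: (@rk_exact _ _ _ rkS _ _ _ (rtens_map pi f) (rtens_map pi q)).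
    by apply: tens_map_surj; apply: coker_piS.
  by apply: tens_exact; [apply: coker_piS|apply: coker_pi_eq0].
move: e; rewrite (@rk_eq0 _ _ _ rkS _ _ (rtens_map pi f) f0) add0e.
rewrite !rk_fin_pres //; last first.
  exact: fin_pres_coker_cyc.
have cfin : rd (coker f) \is a fin_num.
  rewrite ge0_fin_numE ?(syl_ge0 rkS) //; apply: le_lt_trans Nfin.
  by rewrite (syl_coker rkS f) leeDr // (syl_ge0 rkS).
rewrite (syl_coker rkS f) => e; apply: le_anti; rewrite (syl_ge0 rkS) andbT.
by rewrite -(leeD2rE _ _ cfin) e add0e.
Qed.

Lemma rd_coker_pi_map : rd (coker (pi_map pi)) = 0.
Proof.
apply: (rk_cyc_eq0 rkS) => c.
have [N [x [h [Npres <- x0]]]] := pure_eq0_fin_pres (pure1_coker_pi_map c).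
apply: le_anti; rewrite (syl_ge0 rkS) andbT -(rk_cyc_fin_pres Npres x0).
by apply: (rk_comp_l rkS (v := h)) => r; rewrite /= /cyc_map linearZ.
Qed.

End Equivalences.

Local Open Scope ereal_scope.

Theorem theorem8p2 (K : realType) (R S : pzRingType) (pi : {rmorphism R -> S})
    (pi_epi : ring_epi pi) (rkR : map_rank K R) (rkR_syl : sylvester rkR) :
  [<-> exists2 rkS : map_rank K S, sylvester rkS & rkR = pi_star pi rkS;
       forall (M1 M2 : lmodType R) (f : {linear M1 -> M2}),
         rkR (restr pi (tens pi M1)) (restr pi (tens pi M2))
             (restr_map pi (tens_map pi f)) = rkR M1 M2 f;
       forall M : lmodType R, fin_pres M ->
         rkR (restr pi (tens pi M)) (restr pi (tens pi M))
             (restr_map pi (tens_map pi (idl M))) = rkR M M (idl M);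
       rkR R^o (restr pi S^o) (pi_map pi) =
         rkR (restr pi S^o) (restr pi S^o) (idl (restr pi S^o)) /\
       rkR (restr pi S^o) (restr pi S^o) (idl (restr pi S^o)) = 1 ].
Proof.
have rtens_id M : rtens_map pi (idl M) = idl (restr pi (tens pi M)).
  by apply: lin_ext; apply: tens_map_id.
tfae.
- by case=> rkS Ssyl -> M N f; apply: pi_star_rtens.
- by move=> h M _; apply: h.
- move=> h.
  have fp (M : lmodType R) : fin_pres M ->
      rkR _ _ (idl (restr pi (tens pi M))) = rkR _ _ (idl M).
    by move=> /h <-; rewrite -rtens_id.
  have S1 : rkR _ _ (idl (restr pi S^o)) = 1.
    rewrite -(rd_tens_ring pi rkR_syl) fp ?(syl_1 rkR_syl) //.
    exact: fin_pres_ring.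
  split=> //; rewrite (syl_coker rkR_syl (pi_map pi)).
  by rewrite (rd_coker_pi_map pi_epi rkR_syl fp) adde0.
- case=> e S1.
  have C0 : rkR _ _ (idl (coker (pi_map pi))) = 0.
    have := syl_coker rkR_syl (pi_map pi); rewrite e S1 => /esym.
    case: (rkR _ _ _) => [r||] //; rewrite -EFinD => -[].
    by rewrite -[X in _ = X]addr0 => /addrI ->.
  have rkT := rk_tens rkR_syl C0 S1.
  exists (restr_rank pi rkR); first exact: sylvester_restr.
  apply: functional_extensionality_dep => M.
  apply: functional_extensionality_dep => N.
  apply: functional_extensionality_dep => f.
  exact/esym/rkT.
Qed.
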